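(* Let $\Omega$ be a compact domain in $\mathbb{R}^d$ satisfying an interior cone condition. Suppose that the kernel $k$ is a translational invariant kernel with finite smoothness $\tau>d/2$. Then there exists a constant $M>0$ with the following property: if $\epsilon>0$ and $X_N=\{x_1,\dots,x_N\}\subset\Omega$ are given such that $$\|f-\Pi_{V(X_N)}(f)\|_{L^\infty(\Omega)}\le\epsilon\cdot\|f\|_{\mathcal{H}_k(\Omega)}\quad\text{for all } f\in\mathcal{H}_k(\Omega),$$ then the fill distance of $X_N$ satisfies $$h_{X_N}\le M\cdot\epsilon^{1/(\tau-d/2)} .$$
   Context: A kernel on $\Omega\subset\mathbb{R}^d$ is a symmetric function $k:\Omega\times\Omega\to\mathbb{R}$; it is strictly positive definite if for all finite sets of pairwise distinct points $X_N=\{x_1,\dots,x_N\}\subset\Omega$ the matrix $(k(x_i,x_j))_{i,j}$ is positive definite. Its native space $\mathcal{H}_k(\Omega)$ is the unique reproducing kernel Hilbert space of functions on $\Omega$ with reproducing kernel $k$. For a finite set $X_N=\{x_1,\dots,x_N\}\subset\Omega$ of pairwise distinct points, $V(X_N)=\mathrm{span}\{k(\cdot,x_i):x_i\in X_N\}$ and $\Pi_{V(X_N)}$ is the orthogonal projection of $\mathcal{H}_k(\Omega)$ onto $V(X_N)$; $\Pi_{V(X_N)}(f)$ is the unique element of $V(X_N)$ interpolating $f$ on $X_N$. The fill distance is $h_{X_N}=h_{X_N,\Omega}=\sup_{x\in\Omega}\min_{x_i\in X_N}\|x-x_i\|_2$. $k$ is translational invariant if $k(x,y)=\Phi(x-y)$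 for some $\Phi:\mathbb{R}^d\to\mathbb{R}$. It is a kernel of finite smoothness $\tau>d/2$ if its native space is norm equivalent to the Sobolev space $W_2^\tau$; for translational invariant kernels this is the situation in which $c_\Phi(1+\|\omega\|_2^2)^{-\tau}\le\hat\Phi(\omega)\le C_\Phi(1+\|\omega\|_2^2)^{-\tau}$ for all $\omega\in\mathbb{R}^d$ with constants $c_\Phi,C_\Phi>0$, so that $\mathcal{H}_k(\mathbb{R}^d)$ is norm equivalent to $W_2^\tau(\mathbb{R}^d)$, and it is assumed throughout that the boundary of $\Omega$ is regular enough that also $\mathcal{H}_k(\Omega)$ is norm equivalent to $W_2^\tau(\Omega)$. *)

(* Defs.v *)
(* MathComp-Analysis. Points of R^d are row vectors 'rV[R]_d with R : realType.
   The library norm on 'rV[R]_d is the maximum norm, so the Euclidean norm is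
   introduced as enorm; both norms induce the same topology. *)
From HB Require Import structures.
From mathcomp Require Import all_boot all_order all_algebra.
From mathcomp Require Import all_classical all_reals all_analysis.
From mathcomp Require Import complex.

Set Implicit Arguments.
Unset Strict Implicit.
Unset Printing Implicit Defensive.

Import Order.TTheory GRing.Theory Num.Theory.
Import numFieldNormedType.Exports.

Local Open Scope classical_set_scope.
Local Open Scope ring_scope.

Definition rV_display : measure_display.
Proof. exact: default_measure_display. Qed.

(* The product sigma-algebra generated by the coordinates; since R is second
   countable it is the Borel sigma-algebra of 'rV[R]_n. *)
Section rV_measurable.
Variables (R : realType) (n : nat).
Let coors (i : 'I_n) (x : 'rV[R]_n) : measurableTypeR R := x 0 i.
Let rV_set0 : g_sigma_preimage coors set0.
Proof. exact: sigma_algebra0. Qed.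
Let rV_setC A : g_sigma_preimage coors A -> g_sigma_preimage coors (~` A).
Proof. exact: sigma_algebraC. Qed.
Let rV_bigcup (F : _^nat) : (forall i, g_sigma_preimage coors (F i)) ->
  g_sigma_preimage coors (\bigcup_i (F i)).
Proof. exact: sigma_algebra_bigcup. Qed.
HB.instance Definition _ := @isMeasurable.Build rV_display
  'rV[R]_n (g_sigma_preimage coors) rV_set0 rV_setC rV_bigcup.
End rV_measurable.

Definition rV_cons (R : realType) (n : nat) (p : measurableTypeR R * 'rV[R]_n) :
  'rV[R]_n.+1 :=
  \row_i if unlift ord0 i is Some j then p.2 0 j else p.1.

Lemma measurable_coord (R : realType) n (i : 'I_n) :
  measurable_fun setT (fun x : 'rV[R]_n => x 0 i : measurableTypeR R).
Proof.
move=> _ Y mY; rewrite setTI; apply: sub_sigma_algebra => /=.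
rewrite -bigcup_seq/=; exists i => /=; first by rewrite mem_index_enum.
by exists Y => //; rewrite setTI.
Qed.

Lemma measurable_fun_rV (R : realType) n d (T : measurableType d)
    (f : T -> 'rV[R]_n) :
  (forall i, measurable_fun setT (fun t => f t 0 i : measurableTypeR R)) ->
  measurable_fun setT f.
Proof.
move=> mf _ Y mY; rewrite setTI.
suff : g_sigma_preimage (fun i (x : 'rV[R]_n) => x 0 i : measurableTypeR R)
    `<=` [set A | measurable (f @^-1` A)] by apply.
apply: smallest_sub.
  split => /=.
  - by rewrite preimage_set0.
  - by move=> A mA; rewrite setTD -preimage_setC; exact: measurableC.
  - by move=> F mF; rewrite preimage_bigcup; exact: bigcup_measurable.
case: n f mf {Y mY} => [|n] f mf; first by rewrite big_ord0.
rewrite -bigcup_mkord_ord; apply: bigcup_sub => i _ A [B mB <-] /=.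
by rewrite setTI -[X in measurable X]setTI; exact: (mf (inord i)).
Qed.

Lemma measurable_rV_cons (R : realType) n :
  measurable_fun setT (@rV_cons R n).
Proof.
apply: measurable_fun_rV => i.
under eq_fun do rewrite mxE.
case: unliftP => [j _|_]; last exact: measurable_fst.
exact: (measurableT_comp (measurable_coord j) measurable_snd).
Qed.

(* One more coordinate: the image of (Lebesgue on R) x m under rV_cons. *)
Section lebesgue_rV_succ.
Variables (R : realType) (n : nat).
Variable m : {sigma_finite_measure set 'rV[R]_n -> \bar R}.

Local Notation prod := (@lebesgue_measure R \x m)%E.

Definition lebesgue_rV_succ : set 'rV[R]_n.+1 -> \bar R := pushforward prod (@rV_cons R n).

Let mpreimage A : measurable A -> measurable (@rV_cons R n @^-1` A).
Proof.
by move=> mA; rewrite -[X in measurable X]setTI; exact: measurable_rV_cons.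
Qed.

Let lebesgue_rV_succ0 : lebesgue_rV_succ set0 = 0%E.
Proof. by rewrite /lebesgue_rV_succ /pushforward preimage_set0 measure0. Qed.

Let lebesgue_rV_succ_ge0 A : (0 <= lebesgue_rV_succ A)%E.
Proof. by rewrite /lebesgue_rV_succ /pushforward measure_ge0. Qed.

Let lebesgue_rV_succ_sigma_additive : semi_sigma_additive lebesgue_rV_succ.
Proof.
move=> F mF tF mUF; rewrite /lebesgue_rV_succ /pushforward preimage_bigcup.
apply: measure_semi_sigma_additive.
- by move=> i; exact: mpreimage.
- apply/trivIsetP => /= i j _ _ ij; rewrite -preimage_setI.
  by move/trivIsetP : tF => /(_ _ _ _ _ ij) ->//; rewrite preimage_set0.
- by rewrite -preimage_bigcup; exact: mpreimage.
Qed.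

HB.instance Definition _ := isMeasure.Build _ _ _ lebesgue_rV_succ
  lebesgue_rV_succ0 lebesgue_rV_succ_ge0 lebesgue_rV_succ_sigma_additive.

Let lebesgue_rV_succ_sigma_finite : sigma_finite setT lebesgue_rV_succ.
Proof.
have /sigma_finiteP[F [FT ndF Foo]] := sigma_finiteT (@lebesgue_measure R).
have /sigma_finiteP[G [GT ndG Goo]] := sigma_finiteT m.
pose uncons (x : 'rV[R]_n.+1) : measurableTypeR R * 'rV[R]_n :=
  (x 0 ord0, \row_j x 0 (lift ord0 j)).
have consK p : uncons (rV_cons p) = p.
  case: p => a v; congr pair => /=; first by rewrite mxE unlift_none.
  by apply/rowP => j; rewrite !mxE liftK.
have muncons : measurable_fun setT uncons.
  apply/measurable_fun_pair; first exact: measurable_coord.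
  apply: measurable_fun_rV => j; under eq_fun do rewrite mxE.
  exact: measurable_coord.
exists (fun i => uncons @^-1` (F i `*` G i)).
  apply/esym; rewrite -subTset => x _.
  have [i _ Fi] : (\bigcup_i F i) (uncons x).1 by rewrite -FT.
  have [j _ Gj] : (\bigcup_i G i) (uncons x).2 by rewrite -GT.
  exists (maxn i j) => //; split.
    by move: Fi; apply/subsetPset/ndF/leq_maxl.
  by move: Gj; apply/subsetPset/ndG/leq_maxr.
move=> i; have [mFi Fioo] := Foo i; have [mGi Gioo] := Goo i; split.
  by rewrite -[X in measurable X]setTI; apply: muncons => //; exact: measurableX.
rewrite /lebesgue_rV_succ /pushforward -comp_preimage.
rewrite (_ : uncons \o _ = id) ?preimage_id; last first.
  by apply/funext => p /=; rewrite consK.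
by rewrite product_measure1E// lte_mul_pinfty// ge0_fin_numE.
Qed.

HB.instance Definition _ := Measure_isSigmaFinite.Build _ _ _ lebesgue_rV_succ
  lebesgue_rV_succ_sigma_finite.
End lebesgue_rV_succ.

Fixpoint lebesgue_rV (R : realType) (n : nat) :
    {sigma_finite_measure set 'rV[R]_n -> \bar R} :=
  if n is n'.+1 then @lebesgue_rV_succ R n' (lebesgue_rV R n') else \d_(0 : 'rV[R]_0).

Section euclidean.
Variables (R : realType) (d : nat).
Implicit Types x y w : 'rV[R]_d.

Definition dotp x y : R := \sum_(i < d) x 0 i * y 0 i.

Definition enorm x : R := Num.sqrt (dotp x x).

Definition cone x xi (theta r : R) : set 'rV[R]_d :=
  [set z | exists y (l : R), [/\ enorm y = 1, cos theta <= dotp y xi,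
                                 0 <= l <= r & z = x + l *: y]].

Definition interior_cone_condition (Omega : set 'rV[R]_d) : Prop :=
  exists theta r : R, [/\ 0 < theta < pi / 2, 0 < r &
    forall x, Omega x ->
      exists2 xi, enorm xi = 1 & cone x xi theta r `<=` Omega].

(* A compact domain is a compact set that is the closure of a nonempty open
   set; connectedness is not required. *)
Definition compact_domain (Omega : set 'rV[R]_d) : Prop :=
  [/\ compact Omega, Omega !=set0 & closure (interior Omega) = Omega].

(* The infimum runs over a finite set and is a minimum when 0 < N. *)
Definition fill_distance (Omega : set 'rV[R]_d) (N : nat)
    (X : 'I_N -> 'rV[R]_d) : R :=
  sup [set inf (range (fun i => enorm (x - X i))) | x in Omega].

End euclidean.

Section sobolev.
Variables (R : realType) (d : nat).
Local Notation V := 'rV[R]_d.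
Local Notation leb := (lebesgue_rV R d).

Definition sqnormc (z : R[i]) : R := complex.Re z ^+ 2 + complex.Im z ^+ 2.

(* (2 pi)^(-d/2) * int f(x) e^(-i <x, w>) dx, meaningful for integrable f. *)
Definition fourier_integral (f : V -> R) (w : V) : R[i] :=
  ((2 * pi) `^ (- (d%:R / 2)))%:C%C *
  Complex (\int[leb]_x (f x * cos (dotp x w)))
          (- \int[leb]_x (f x * sin (dotp x w))).

(* fh is a representative of the L^2 (Plancherel) Fourier transform of f in
   L^2(R^d): the transforms of the truncations of f to the balls |x| <= r
   converge to fh in L^2(R^d) as r tends to infinity.  For f in L^1 and L^2 this
   means that fh is a.e. equal to fourier_integral f. *)
Definition is_fourier (f : V -> R) (fh : V -> R[i]) : Prop :=
  [/\ f \in Lfun leb 2%:E,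
      measurable_fun setT (fun w => complex.Re (fh w)),
      measurable_fun setT (fun w => complex.Im (fh w)) &
      (fun r : R => \int[leb]_w
          (sqnormc (fh w - fourier_integral (f \_ [set x | enorm x <= r]) w))%:E)%E
        @ +oo --> 0%E].

(* The norm of W_2^tau(R^d).  The transform is unique a.e., so the infimum only
   discards the choice of representative; it is +oo if f is not in L^2. *)
Definition sobolev_norm (tau : R) (f : V -> R) : \bar R :=
  ereal_inf [set ((\int[leb]_w
                     ((1 + enorm w ^+ 2) `^ tau * sqnormc (fh w))%:E) `^ 2^-1)%E
            | fh in is_fourier f].

(* The norm of W_2^tau(Omega), the space of restrictions to Omega (up to
   a.e. equality) of the elements of W_2^tau(R^d), with the quotient norm; it is
   +oo if f has no extension in W_2^tau(R^d). *)
Definition sobolev_norm_on (Omega : set V) (tau : R) (f : V -> R) : \bar R :=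
  ereal_inf [set sobolev_norm tau F
            | F in [set F | {ae leb, forall x, Omega x -> f x = F x}]].

(* c (1 + |w|^2)^-tau <= Phihat(w) <= C (1 + |w|^2)^-tau for a real-valued
   representative of the Fourier transform of the continuous function Phi. *)
Definition fourier_decay (tau : R) (Phi : V -> R) : Prop :=
  continuous Phi /\
  exists (Phih : V -> R) (c C : R),
    [/\ is_fourier Phi (fun w => (Phih w)%:C%C), 0 < c, 0 < C &
        forall w, c * (1 + enorm w ^+ 2) `^ (- tau) <= Phih w
                  <= C * (1 + enorm w ^+ 2) `^ (- tau)].

End sobolev.

Section native_space.
Variables (R : realType) (d : nat).
Local Notation V := 'rV[R]_d.
Local Notation leb := (lebesgue_rV R d).

(* Kernels on Omega are given by functions on R^d x R^d of which only the values
   on Omega x Omega are used. *)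
Definition strictly_pd_kernel (Omega : set V) (k : V -> V -> R) : Prop :=
  (forall x y, Omega x -> Omega y -> k x y = k y x) /\
  (forall (N : nat) (X : 'I_N -> V) (a : 'I_N -> R),
     injective X -> (forall i, Omega (X i)) -> (exists i, a i != 0) ->
     0 < \sum_(i < N) \sum_(j < N) a i * a j * k (X i) (X j)).

Definition translational_invariant (Omega : set V) (k : V -> V -> R)
    (Phi : V -> R) : Prop :=
  forall x y, Omega x -> Omega y -> k x y = Phi (x - y).

(* Functions on Omega are represented by their extension by zero to R^d. *)
Definition kernel_section (Omega : set V) (k : V -> V -> R) (x : V) : V -> R :=
  (fun y => k y x) \_ Omega.

(* A Hilbert space of functions on Omega with reproducing kernel k; given Omega
   and k, carrier and the restriction of inner to it are uniquely determined. *)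
Record native_space (Omega : set V) (k : V -> V -> R) := NativeSpace {
  carrier : set (V -> R);
  inner : (V -> R) -> (V -> R) -> R;
  carrier_on : forall f x, carrier f -> ~ Omega x -> f x = 0;
  carrier0 : carrier (fun=> 0);
  carrier_lin : forall (a : R) f g, carrier f -> carrier g ->
    carrier (fun x => a * f x + g x);
  inner_sym : forall f g, carrier f -> carrier g -> inner f g = inner g f;
  inner_lin : forall (a : R) f g h, carrier f -> carrier g -> carrier h ->
    inner (fun x => a * f x + g x) h = a * inner f h + inner g h;
  inner_ge0 : forall f, carrier f -> 0 <= inner f f;
  inner_eq0 : forall f, carrier f -> inner f f = 0 -> forall x, f x = 0;
  carrier_complete : forall u : nat -> V -> R, (forall n, carrier (u n)) ->
    (forall e : R, 0 < e -> exists n0, forall m n, (n0 <= m)%N -> (n0 <= n)%N ->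
       Num.sqrt (inner (u m \- u n) (u m \- u n)) < e) ->
    exists2 f, carrier f &
      (fun n => Num.sqrt (inner (u n \- f) (u n \- f))) @ \oo --> (0 : R);
  carrier_kernel : forall x, Omega x -> carrier (kernel_section Omega k x);
  inner_reproducing : forall f x, carrier f -> Omega x ->
    inner f (kernel_section Omega k x) = f x
}.

Section with_native_space.
Variables (Omega : set V) (k : V -> V -> R) (H : native_space Omega k).

Definition native_norm (f : V -> R) : R := Num.sqrt (inner H f f).

Definition kernel_span (N : nat) (X : 'I_N -> V) : set (V -> R) :=
  [set s | exists a : 'I_N -> R,
     s = fun y => \sum_(i < N) a i * kernel_section Omega k (X i) y].

Definition is_orth_proj (W : set (V -> R)) (f p : V -> R) : Prop :=
  W p /\ forall s, W s -> inner H (f \- p) s = 0.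

(* The projection onto a finite-dimensional W exists and is unique, so the
   default value 0 is never used for W = kernel_span X and f in H. *)
Definition orth_proj (W : set (V -> R)) (f : V -> R) : V -> R :=
  xget (fun=> 0) [set p | is_orth_proj W f p].

Definition norm_equiv_sobolev (tau : R) : Prop :=
  (exists c C : R, [/\ 0 < c, 0 < C &
     forall f, carrier H f ->
       (c%:E * sobolev_norm_on Omega tau f <= (native_norm f)%:E
        /\ (native_norm f)%:E <= C%:E * sobolev_norm_on Omega tau f)%E]) /\
  (forall F : V -> R, (sobolev_norm_on Omega tau F < +oo)%E ->
     exists2 f, carrier H f & {ae leb, forall x, Omega x -> f x = F x}).

(* For a translational invariant kernel with profile Phi. *)
Definition finite_smoothness (tau : R) (Phi : V -> R) : Prop :=
  fourier_decay tau Phi /\ norm_equiv_sobolev tau.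

End with_native_space.

Definition Linfty_norm (Omega : set V) (g : V -> R) : \bar R :=
  Lnorm leb +oo%E (EFin \o (g \_ Omega)).

End native_space.

(* Main.v *)
(* Let h be the distance from a point x of Omega to X, and put rho := h / d.
   A tensor product F of the one-dimensional bumps
   max(0, 1 - ((t - x_i) / rho)^2)^m vanishes on X and F x = 1, so the element f
   of the native space which coincides with F on Omega has projection 0 onto
   V(X).  The hypothesis then reads 1 <= eps * |f|_H, and |f|_H is at most a
   constant times the Sobolev norm of F, which is of order rho^(d/2 - tau).
   For the latter, m integrations by parts bound the squared modulus of the
   one-dimensional Fourier transforms by K rho^2 / (1 + (rho w)^2)^m, while
   1 + |w|^2 <= (D / rho)^2 prod_i (1 + (rho w_i)^2) for rho <= D with 1 <= D, so
   that the Sobolev integral is dominated by a product of integrals of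
   1 / (1 + (rho w_i)^2). *)

Require Import Defs.
From mathcomp Require Import all_boot all_order all_algebra.
From mathcomp Require Import all_classical all_reals all_analysis.
From mathcomp Require Import measurable_realfun ess_sup_inf.
From mathcomp Require Import complex ring lra.

Set Implicit Arguments.
Unset Strict Implicit.
Unset Printing Implicit Defensive.

Import Order.TTheory GRing.Theory Num.Theory.
Import numFieldNormedType.Exports.

Local Open Scope classical_set_scope.
Local Open Scope ring_scope.

(** * Tensor products and their Fourier transforms *)

Section product.
Context d1 d2 (T1 : measurableType d1) (T2 : measurableType d2) (R : realType).
Variables (m1 : {sigma_finite_measure set T1 -> \bar R})
  (m2 : {sigma_finite_measure set T2 -> \bar R}).
Variables (u : T1 -> R) (v : T2 -> R).
Hypotheses (iu : m1.-integrable setT (EFin \o u))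
  (iv : m2.-integrable setT (EFin \o v)).

Lemma integrable_prodM :
  (m1 \x m2)%E.-integrable setT (fun z => (u z.1 * v z.2)%:E).
Proof.
have mu : measurable_fun setT u by apply/measurable_EFinP; case/integrableP : iu.
have mv : measurable_fun setT v by apply/measurable_EFinP; case/integrableP : iv.
apply/integrable12ltyP.
  apply/measurable_EFinP; apply: measurable_funM;
    exact: measurableT_comp.
rewrite /=.
have iv' : (\int[m2]_y `|(v y)%:E| \is a fin_num)%E.
  by case/integrableP : iv => _ ivoo; rewrite ge0_fin_numE//; exact: integral_ge0.
under eq_integral => x _.
  under eq_integral do rewrite normrM EFinM.
  rewrite ge0_integralZl//; first over.
  by apply/measurable_EFinP; apply: measurableT_comp.
have -> : (fun x : T1 => (`|u x|%:E * \int[m2]_y `|v y|%:E)%E) =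
  (fun x => (fine (\int[m2]_y `|v y|%:E))%:E * `|u x|%:E)%E.
  by apply/funext => x; rewrite fineK// muleC.
rewrite ge0_integralZl//; last 2 first.
- by apply/measurable_EFinP; apply: measurableT_comp.
- by rewrite lee_fin fine_ge0//; exact: integral_ge0.
apply: lte_mul_pinfty => //.
- by rewrite lee_fin fine_ge0//; exact: integral_ge0.
- by case/integrableP : iu.
Qed.

Lemma Rintegral_prodM :
  \int[(m1 \x m2)%E]_z (u z.1 * v z.2) = (\int[m1]_x u x) * \int[m2]_y v y.
Proof.
rewrite {1}/Rintegral -integral12_prod_meas1; last exact: integrable_prodM.
rewrite /fubini_F/=.
under eq_integral => x _.
  under eq_integral do rewrite EFinM.
  rewrite integralZl//.
  rewrite -[X in (_ * X)%E]fineK; last exact: integrable_fin_num.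
  rewrite muleC -EFinM.
  over.
rewrite /=.
under eq_integral do rewrite EFinM.
rewrite integralZl// fineM// ?integrable_fin_num//.
by rewrite mulrC.
Qed.
End product.

(** * Splitting off the first coordinate of R^(n+1) *)

Definition rV_behead (R : realType) n (x : 'rV[R]_n.+1) : 'rV[R]_n :=
  \row_j x 0 (lift ord0 j).

Section rV_succ.
Variables (R : realType) (n : nat).
Local Notation leb := (lebesgue_rV R n.+1).

Lemma rV_behead_cons (p : measurableTypeR R * 'rV[R]_n) :
  rV_behead (rV_cons p) = p.2.
Proof. by apply/rowP => j; rewrite !mxE liftK. Qed.

Lemma rV_cons_ord0 (p : measurableTypeR R * 'rV[R]_n) : rV_cons p 0 ord0 = p.1.
Proof. by rewrite mxE unlift_none. Qed.

Lemma measurable_rV_behead : measurable_fun setT (@rV_behead R n).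
Proof.
apply: measurable_fun_rV => j; under eq_fun do rewrite mxE.
exact: measurable_coord.
Qed.

Variables (u : R -> R) (v : 'rV[R]_n -> R).
Hypotheses (iu : (@lebesgue_measure R).-integrable setT (EFin \o u))
  (iv : (lebesgue_rV R n).-integrable setT (EFin \o v)).
Let f (x : 'rV[R]_n.+1) := u (x 0 ord0) * v (rV_behead x).

Let fE : f \o (@rV_cons R n) = (fun z => u z.1 * v z.2).
Proof. by apply/funext => z; rewrite /f/= rV_behead_cons rV_cons_ord0. Qed.

Let mf : measurable_fun setT f.
Proof.
have mu : measurable_fun setT u by apply/measurable_EFinP; case/integrableP : iu.
have mv : measurable_fun setT v by apply/measurable_EFinP; case/integrableP : iv.
apply: measurable_funM.
  by apply: (measurableT_comp mu); exact: measurable_coord.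
by apply: (measurableT_comp mv); exact: measurable_rV_behead.
Qed.

Let if_cons : (@lebesgue_measure R \x lebesgue_rV R n)%E.-integrable
  (@rV_cons R n @^-1` setT) ((EFin \o f) \o @rV_cons R n).
Proof. by rewrite preimage_setT -compA fE; exact: integrable_prodM iu iv. Qed.

(** [lebesgue_rV R n.+1] is by construction the image of a product measure under [rV_cons], and
    pulling the integrand back along [rV_cons] separates the two variables. *)
Lemma integrable_rV_succ :
  leb.-integrable setT (fun x => (u (x 0 ord0) * v (rV_behead x))%:E).
Proof.
exact: (integrable_pushforward (@measurable_rV_cons R n)
  ((measurable_EFinP _ _).2 mf) if_cons measurableT).
Qed.

Lemma Rintegral_rV_succ :
  \int[leb]_x (u (x 0 ord0) * v (rV_behead x)) =
  (\int[lebesgue_measure]_t u t) * \int[lebesgue_rV R n]_y v y.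
Proof.
rewrite -Rintegral_prodM// /Rintegral; congr fine.
rewrite (integral_pushforward (@measurable_rV_cons R n)
  ((measurable_EFinP _ _).2 mf) if_cons measurableT).
by rewrite preimage_setT -compA fE.
Qed.
End rV_succ.

(** * Tensor products of functions of one variable *)

Section tensor.
Variable R : realType.
Local Notation mu := (@lebesgue_measure R).

Definition tensor n (g : 'I_n -> R -> R) (x : 'rV[R]_n) : R :=
  \prod_(i < n) g i (x 0 i).

Lemma tensor_succ n (g : 'I_n.+1 -> R -> R) (x : 'rV[R]_n.+1) :
  tensor g x = g ord0 (x 0 ord0) * tensor (fun i => g (lift ord0 i)) (rV_behead x).
Proof.
by rewrite /tensor big_ord_recl; congr *%R; apply: eq_bigr => i _; rewrite mxE.
Qed.

Lemma tensor0 (g : 'I_0 -> R -> R) (x : 'rV[R]_0) : tensor g x = 1.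
Proof. by rewrite /tensor big_ord0. Qed.

Lemma dotp_succ n (x w : 'rV[R]_n.+1) :
  dotp x w = x 0 ord0 * w 0 ord0 + dotp (rV_behead x) (rV_behead w).
Proof.
by rewrite /dotp big_ord_recl; congr +%R; apply: eq_bigr => i _; rewrite !mxE.
Qed.

Lemma measurable_rV_fun0 (f : 'rV[R]_0 -> R) : measurable_fun setT f.
Proof.
have -> : f = cst (f 0) by apply/funext => x; rewrite /= [x]thinmx0.
exact: measurable_cst.
Qed.

Lemma integrable_tensor n (g : 'I_n -> R -> R) :
  (forall i, mu.-integrable setT (EFin \o g i)) ->
  (lebesgue_rV R n).-integrable setT (EFin \o tensor g).
Proof.
elim: n g => [g _|n IHn g ig].
  apply/integrableP; split; first by apply/measurable_EFinP; exact: measurable_rV_fun0.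
  (* The measure on R^0 is a Dirac mass and the empty tensor product is 1. *)
  rewrite /lebesgue_rV/= integral_dirac//.
    by rewrite diracT mul1e ltry.
  apply/measurable_EFinP.
  exact: measurable_rV_fun0.
have := integrable_rV_succ (ig ord0) (IHn _ (fun i => ig (lift ord0 i))).
by apply: eq_integrable => // x _ /=; rewrite tensor_succ.
Qed.

Lemma Rintegral_tensor n (g : 'I_n -> R -> R) :
  (forall i, mu.-integrable setT (EFin \o g i)) ->
  \int[lebesgue_rV R n]_x tensor g x = \prod_(i < n) \int[mu]_t g i t.
Proof.
elim: n g => [g _|n IHn g ig].
  rewrite big_ord0 /Rintegral /lebesgue_rV/= integral_dirac//; last first.
    by apply/measurable_EFinP; exact: measurable_rV_fun0.
  by rewrite diracT mul1e/= tensor0.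
rewrite big_ord_recl -IHn; last by move=> i; exact: ig.
rewrite -Rintegral_rV_succ//; last exact: (integrable_tensor (fun i => ig (lift ord0 i))).
by apply: eq_Rintegral => x _; rewrite tensor_succ.
Qed.

Lemma measurable_tensor n (g : 'I_n -> R -> R) :
  (forall i, measurable_fun setT (g i)) -> measurable_fun setT (tensor g).
Proof.
move=> mg; apply: measurable_prod => i _.
by apply: measurableT_comp => //; exact: measurable_coord.
Qed.

(** Up to normalisation the Fourier transform is [cos_int] minus i times [sin_int]; keeping the two
    parts separate leaves only real integrals to handle. *)
Definition cos_int (u : R -> R) (w : R) : R := \int[mu]_t (u t * cos (t * w)).
Definition sin_int (u : R -> R) (w : R) : R := \int[mu]_t (u t * sin (t * w)).

Definition cos_int_rV n (f : 'rV[R]_n -> R) (w : 'rV[R]_n) : R :=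
  \int[lebesgue_rV R n]_x (f x * cos (dotp x w)).
Definition sin_int_rV n (f : 'rV[R]_n -> R) (w : 'rV[R]_n) : R :=
  \int[lebesgue_rV R n]_x (f x * sin (dotp x w)).

Lemma integrableM_bounded d (T : measurableType d)
    (m : {measure set T -> \bar R}) (f h : T -> R) :
  m.-integrable setT (EFin \o f) -> measurable_fun setT h ->
  (forall x, `|h x| <= 1) -> m.-integrable setT (EFin \o (fun x => f x * h x)).
Proof.
move=> /integrableP[/measurable_EFinP mf foo] mh h1.
apply/integrableP; split; first exact/measurable_EFinP/measurable_funM.
apply: le_lt_trans foo; apply: ge0_le_integral => //.
- by apply: measurableT_comp => //; exact/measurable_EFinP/measurable_funM.
- by apply: measurableT_comp => //; exact/measurable_EFinP.
- by move=> x _; rewrite lee_fin normrM ler_piMr.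
Qed.

Lemma normr_cos_le1 (x : R) : `|cos x| <= 1.
Proof. by rewrite ler_norml cos_geN1 cos_le1. Qed.

Lemma normr_sin_le1 (x : R) : `|sin x| <= 1.
Proof. by rewrite ler_norml sin_geN1 sin_le1. Qed.

Lemma continuous_cosM (w : R) : continuous (fun t : R => cos (t * w)).
Proof.
move=> t; apply: continuous_comp; [exact: mulrr_continuous|exact: continuous_cos].
Qed.

Lemma continuous_sinM (w : R) : continuous (fun t : R => sin (t * w)).
Proof.
move=> t; apply: continuous_comp; [exact: mulrr_continuous|exact: continuous_sin].
Qed.

Lemma measurable_cosM (w : R) : measurable_fun setT (fun t : R => cos (t * w)).
Proof. by apply: continuous_measurable_fun; exact: continuous_cosM. Qed.

Lemma measurable_sinM (w : R) : measurable_fun setT (fun t : R => sin (t * w)).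
Proof. by apply: continuous_measurable_fun; exact: continuous_sinM. Qed.

Lemma measurable_dotp n (w : 'rV[R]_n) : measurable_fun setT (fun x => dotp x w).
Proof.
apply: measurable_sum => i; apply: measurable_funM => //.
exact: measurable_coord.
Qed.

Lemma measurable_cos_dotp n (w : 'rV[R]_n) :
  measurable_fun setT (fun x => cos (dotp x w)).
Proof.
apply: (measurableT_comp _ (measurable_dotp w)).
by apply: continuous_measurable_fun; exact: continuous_cos.
Qed.

Lemma measurable_sin_dotp n (w : 'rV[R]_n) :
  measurable_fun setT (fun x => sin (dotp x w)).
Proof.
apply: (measurableT_comp _ (measurable_dotp w)).
by apply: continuous_measurable_fun; exact: continuous_sin.
Qed.

Section fourier_tensor.
Variables (n : nat) (g : 'I_n.+1 -> R -> R).
Hypothesis ig : forall i, mu.-integrable setT (EFin \o g i).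
Let g' i := g (lift ord0 i).
Let icos (w : R) : mu.-integrable setT (EFin \o (fun t => g ord0 t * cos (t * w))).
Proof.
by apply: integrableM_bounded => //;
  [exact: measurable_cosM|move=> x; exact: normr_cos_le1].
Qed.
Let isin (w : R) : mu.-integrable setT (EFin \o (fun t => g ord0 t * sin (t * w))).
Proof.
by apply: integrableM_bounded => //;
  [exact: measurable_sinM|move=> x; exact: normr_sin_le1].
Qed.
Let icos' w : (lebesgue_rV R n).-integrable setT
  (EFin \o (fun x => tensor g' x * cos (dotp x w))).
Proof.
apply: integrableM_bounded;
  [exact: (integrable_tensor (fun i => ig (lift ord0 i)))|
   exact: measurable_cos_dotp|by move=> x; exact: normr_cos_le1].
Qed.
Let isin' w : (lebesgue_rV R n).-integrable setT
  (EFin \o (fun x => tensor g' x * sin (dotp x w))).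
Proof.
apply: integrableM_bounded;
  [exact: (integrable_tensor (fun i => ig (lift ord0 i)))|
   exact: measurable_sin_dotp|by move=> x; exact: normr_sin_le1].
Qed.

(** The addition formula splits the cosine of [dotp x w] into two products of a function of the
    first coordinate and a function of the others, and each of them factors by Fubini. Together with
    the sine version this is complex multiplication of the two transforms. *)
Lemma cos_int_tensor_succ w : cos_int_rV (tensor g) w =
  cos_int (g ord0) (w 0 ord0) * cos_int_rV (tensor g') (rV_behead w) -
  sin_int (g ord0) (w 0 ord0) * sin_int_rV (tensor g') (rV_behead w).
Proof.
rewrite -!Rintegral_rV_succ// -RintegralB//;
  [|exact: (integrable_rV_succ (icos _) (icos' _))|
    exact: (integrable_rV_succ (isin _) (isin' _))].
apply: eq_Rintegral => x _; rewrite tensor_succ dotp_succ cosD.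
by rewrite -/g'; ring.
Qed.

Lemma sin_int_tensor_succ w : sin_int_rV (tensor g) w =
  sin_int (g ord0) (w 0 ord0) * cos_int_rV (tensor g') (rV_behead w) +
  cos_int (g ord0) (w 0 ord0) * sin_int_rV (tensor g') (rV_behead w).
Proof.
rewrite -!Rintegral_rV_succ// -RintegralD//;
  [|exact: (integrable_rV_succ (isin _) (icos' _))|
    exact: (integrable_rV_succ (icos _) (isin' _))].
apply: eq_Rintegral => x _; rewrite tensor_succ dotp_succ sinD.
by rewrite -/g'; ring.
Qed.
End fourier_tensor.

(** The modulus is multiplicative: by the addition formulas the inductive step is the identity (ac -
    bd)^2 + (bc + ad)^2 = (a^2 + b^2)(c^2 + d^2). *)
Lemma sqr_fourier_tensor n (g : 'I_n -> R -> R) w :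
  (forall i, mu.-integrable setT (EFin \o g i)) ->
  cos_int_rV (tensor g) w ^+ 2 + sin_int_rV (tensor g) w ^+ 2 =
  \prod_(i < n) (cos_int (g i) (w 0 i) ^+ 2 + sin_int (g i) (w 0 i) ^+ 2).
Proof.
elim: n g w => [g w _|n IHn g w ig].
  rewrite big_ord0 /cos_int_rV /sin_int_rV /Rintegral /lebesgue_rV/=.
  rewrite !integral_dirac//; try by apply/measurable_EFinP; exact: measurable_rV_fun0.
  rewrite diracT !mul1e/= tensor0 !mul1r /dotp big_ord0 cos0 sin0.
  by rewrite expr1n expr0n/= addr0.
rewrite cos_int_tensor_succ// sin_int_tensor_succ// big_ord_recl.
transitivity ((cos_int (g ord0) (w 0 ord0) ^+ 2 + sin_int (g ord0) (w 0 ord0) ^+ 2) *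
  \prod_(i < n) (cos_int (g (lift ord0 i)) (rV_behead w 0 i) ^+ 2 +
                 sin_int (g (lift ord0 i)) (rV_behead w 0 i) ^+ 2)); last first.
  by congr *%R; apply: eq_bigr => i _; rewrite !mxE.
rewrite -IHn; last by move=> i; exact: ig.
ring.
Qed.

(** Both integrals are continuous in the frequency by dominated convergence, with majorant [|u|];
    the interval from [w - 1] to [w + 1] merely serves as a neighbourhood of [w]. *)
Lemma measurable_cos_sin_int (u : R -> R) : mu.-integrable setT (EFin \o u) ->
  measurable_fun setT (cos_int u) /\ measurable_fun setT (sin_int u).
Proof.
move=> iu; split; apply: continuous_measurable_fun => w.
  apply: (@continuity_under_integral R _ _ mu (fun w t => u t * cos (t * w)) setT
     measurableT (w - 1) (w + 1) _ _ (fun t => `|u t|)).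
  - move=> x _; apply: integrableM_bounded => //;
      [exact: measurable_cosM|by move=> ?; exact: normr_cos_le1].
  - apply: aeW => t _ x _; apply: continuousM; first exact: cst_continuous.
    apply: continuous_comp; [exact: mulrl_continuous|exact: continuous_cos].
  - exact: (integrable_norm iu).
  - by move=> x _; apply: aeW => t _; rewrite normrM ler_piMr// normr_cos_le1.
  - by rewrite inE/= in_itv/=; apply/andP; split; lra.
apply: (@continuity_under_integral R _ _ mu (fun w t => u t * sin (t * w)) setT
     measurableT (w - 1) (w + 1) _ _ (fun t => `|u t|)).
- move=> x _; apply: integrableM_bounded => //;
      [exact: measurable_sinM|by move=> ?; exact: normr_sin_le1].
- apply: aeW => t _ x _; apply: continuousM; first exact: cst_continuous.
  apply: continuous_comp; [exact: mulrl_continuous|exact: continuous_sin].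
- exact: (integrable_norm iu).
- by move=> x _; apply: aeW => t _; rewrite normrM ler_piMr// normr_sin_le1.
- by rewrite inE/= in_itv/=; apply/andP; split; lra.
Qed.

Lemma measurable_fourier_tensor n (g : 'I_n -> R -> R) :
  (forall i, mu.-integrable setT (EFin \o g i)) ->
  measurable_fun setT (cos_int_rV (tensor g)) /\
  measurable_fun setT (sin_int_rV (tensor g)).
Proof.
elim: n g => [|n IHn] g ig; first by split; exact: measurable_rV_fun0.
have [mc ms] := measurable_cos_sin_int (ig ord0).
have [mC mS] := IHn _ (fun i => ig (lift ord0 i)).
have mc' : measurable_fun setT (fun w : 'rV[R]_n.+1 => cos_int (g ord0) (w 0 ord0)).
  by apply: (measurableT_comp mc); exact: measurable_coord.
have ms' : measurable_fun setT (fun w : 'rV[R]_n.+1 => sin_int (g ord0) (w 0 ord0)).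
  by apply: (measurableT_comp ms); exact: measurable_coord.
have mC' := measurableT_comp mC (@measurable_rV_behead R n).
have mS' := measurableT_comp mS (@measurable_rV_behead R n).
split.
  rewrite (funext (cos_int_tensor_succ ig)).
  exact: (measurable_funB (measurable_funM mc' mC') (measurable_funM ms' mS')).
rewrite (funext (sin_int_tensor_succ ig)).
exact: (measurable_funD (measurable_funM ms' mC') (measurable_funM mc' mS')).
Qed.
End tensor.

(** * Fourier decay of the bumps *)

Section bump.
Variable R : realType.
Local Notation mu := (@lebesgue_measure R).
Implicit Types (p q r : {poly R}) (a b w t rho : R).

Lemma Rintegration_by_parts_derive (F G f g : R -> R) a b : a < b ->
  continuous f -> continuous g ->
  (forall t, is_derive t 1 F (f t)) -> (forall t, is_derive t 1 G (g t)) ->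
  F a = 0 -> F b = 0 ->
  \int[mu]_(t in `[a, b]) (F t * g t) = - \int[mu]_(t in `[a, b]) (f t * G t).
Proof.
move=> ab cf cg dF dG Fa Fb.
have LR (h h' : R -> R) : (forall t, is_derive t 1 h (h' t)) ->
    derivable_oo_LRcontinuous h a b.
  move=> dh.
  have ch : continuous h.
    by move=> t; apply/differentiable_continuous/derivable1_diffP; exact: ex_derive.
  split; first by move=> t _; exact: ex_derive.
  - by apply: cvg_at_right_filter; exact: ch.
  - by apply: cvg_at_left_filter; exact: ch.
rewrite (Rintegration_by_parts ab (f := f) (G := G)).
- by rewrite Fa Fb !mul0r subrr sub0r.
- exact: continuous_subspaceT.
- exact: LR dF.
- by move=> t _; rewrite derive1E; exact: derive_val.
- exact: continuous_subspaceT.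
- exact: LR dG.
- by move=> t _; rewrite derive1E; exact: derive_val.
Qed.

Lemma is_derive_mull w t : is_derive t (1 : R) ( *%R w) w.
Proof.
have -> : *%R w = (fun x : R => w *: (x : R^o)) by [].
by apply: is_derive_eq; rewrite scaler1.
Qed.

Lemma is_derive_sinM w t :
  is_derive t 1 (fun t : R => sin (t * w)) (w * cos (t * w)).
Proof.
have -> : (fun t : R => sin (t * w)) = sin \o *%R w.
  by apply/funext => u /=; rewrite mulrC.
have dw := is_derive_mull w t.
by apply: is_derive_eq; rewrite mulrC [t * w]mulrC.
Qed.

Lemma is_derive_cosM w t :
  is_derive t 1 (fun t : R => cos (t * w)) (- w * sin (t * w)).
Proof.
have -> : (fun t : R => cos (t * w)) = cos \o *%R w.
  by apply/funext => u /=; rewrite mulrC.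
have dw := is_derive_mull w t.
by apply: is_derive_eq; rewrite mulrC [t * w]mulrC mulNr mulrN.
Qed.

Lemma integrable_itv (f : R -> R) a b : continuous f ->
  mu.-integrable `[a, b] (EFin \o f).
Proof.
move=> cf; apply: continuous_compact_integrable; first exact: segment_compact.
exact: continuous_subspaceT.
Qed.

(** The factor [w] turns the cosine into the derivative of [sin (t * w)]; the zeros of [p] at the
    endpoints remove the boundary terms. A power of the frequency is thus traded for a derivative of
    [p]. *)
Lemma horner_cos_parts p a b w : a < b -> p.[a] = 0 -> p.[b] = 0 ->
  w * \int[mu]_(t in `[a, b]) (p.[t] * cos (t * w)) =
  - \int[mu]_(t in `[a, b]) (p^`().[t] * sin (t * w)).
Proof.
move=> ab pa pb.
have cg : continuous (fun t => w * cos (t * w)).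
  by move=> t; apply: cvgM; [exact: cvg_cst|exact: continuous_cosM].
rewrite -(Rintegration_by_parts_derive ab (@continuous_horner _ _) cg
  (is_derive_poly p) (is_derive_sinM w) pa pb) -RintegralZl//.
  by apply: eq_Rintegral => t _; rewrite mulrCA.
apply: integrable_itv => t; apply: cvgM; first exact: continuous_horner.
exact: continuous_cosM.
Qed.

Lemma horner_sin_parts p a b w : a < b -> p.[a] = 0 -> p.[b] = 0 ->
  w * \int[mu]_(t in `[a, b]) (p.[t] * sin (t * w)) =
  \int[mu]_(t in `[a, b]) (p^`().[t] * cos (t * w)).
Proof.
move=> ab pa pb.
have cg : continuous (fun t => - w * sin (t * w)).
  by move=> t; apply: cvgM; [exact: cvg_cst|exact: continuous_sinM].
apply: oppr_inj; rewrite -(Rintegration_by_parts_derive ab (@continuous_horner _ _) cg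
  (is_derive_poly p) (is_derive_cosM w) pa pb) -mulNr -RintegralZl//.
  by apply: eq_Rintegral => t _; rewrite mulrCA.
apply: integrable_itv => t; apply: cvgM; first exact: continuous_horner.
exact: continuous_sinM.
Qed.

Lemma horner_bound_itv p : exists2 K : R, 0 <= K &
  forall t, `|t| <= 1 -> `|p.[t]| <= K.
Proof.
exists (\sum_(i < size p) `|p`_i|); first exact: sumr_ge0.
move=> t t1; rewrite horner_coef (le_trans (ler_norm_sum _ _ _))//.
by apply: ler_sum => i _; rewrite normrM ler_piMr// normrX exprn_ile1.
Qed.

(** The affine map from [a - rho, a + rho] onto [-1, 1]. All bumps come from one polynomial by
    composition with it, so bounds can be uniform in the centre and the radius. *)
Definition rescale a rho : {poly R} := rho^-1 *: ('X - a%:P).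

Lemma horner_rescale p a rho t :
  (p \Po rescale a rho).[t] = p.[(t - a) / rho].
Proof. by rewrite horner_comp /rescale !hornerE mulrC. Qed.

Lemma deriv_rescale p a rho :
  (p \Po rescale a rho)^`() = rho^-1 *: (p^`() \Po rescale a rho).
Proof.
rewrite deriv_comp /rescale derivZ derivXsubC mulrC -scalerAl mul1r.
by [].
Qed.

Lemma itv_rescale a rho t : 0 < rho -> t \in `[a - rho, a + rho] ->
  `|(t - a) / rho| <= 1.
Proof.
move=> rho0; rewrite in_itv/= => /andP[h1 h2].
rewrite normrM normfV (gtr0_norm rho0) ler_pdivrMr// mul1r ler_norml.
by apply/andP; split; lra.
Qed.

Lemma Rintegral_itv_le (f : R -> R) a rho K : 0 < rho -> continuous f ->
  (forall t, t \in `[a - rho, a + rho] -> `|f t| <= K) ->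
  `|\int[mu]_(t in `[a - rho, a + rho]) f t| <= 2 * K * rho.
Proof.
move=> rho0 cf fK.
apply: le_trans (le_normr_Rintegral _ (integrable_itv _ _ cf)) _ => //.
apply: (@le_trans _ _ (\int[mu]_(t in `[a - rho, a + rho]) K)).
  apply: le_Rintegral => //.
  - by apply: (integrable_norm (integrable_itv _ _ cf)).
  - by apply: integrable_itv => t; exact: cvg_cst.
rewrite Rintegral_cst//= lebesgue_measure_itv/= lte_fin.
rewrite ifT; last by lra.
by rewrite -EFinD/=; lra.
Qed.

(** Each integration by parts uses up one factor [1 - 'X ^+ 2], which vanishes at the endpoints, and
    the chain rule yields a [rho^-1] that cancels the [rho] in [rho * w]. The cofactor [r] is
    arbitrary because differentiation changes it. *)
Lemma horner_fourier_decay m r : exists2 K : R, 0 <= K &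
  forall a rho w, 0 < rho ->
    let p := ((1 - 'X ^+ 2) ^+ m * r) \Po rescale a rho in
    `|rho * w| ^+ m * `|\int[mu]_(t in `[a - rho, a + rho]) (p.[t] * cos (t * w))|
      <= K * rho /\
    `|rho * w| ^+ m * `|\int[mu]_(t in `[a - rho, a + rho]) (p.[t] * sin (t * w))|
      <= K * rho.
Proof.
elim: m r => [r|m IHm r].
  have [K K0 rK] := horner_bound_itv r.
  exists (2 * K); first by rewrite mulr_ge0.
  move=> a rho w rho0 p; rewrite !expr0 !mul1r.
  have pK t : t \in `[a - rho, a + rho] -> `|p.[t]| <= K.
    by move=> tI; rewrite horner_rescale expr0 mul1r rK// itv_rescale.
  split; apply: Rintegral_itv_le => //.
  - by move=> t; apply: cvgM; [exact: continuous_horner|exact: continuous_cosM].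
  - move=> t tI; rewrite normrM (le_trans _ (pK t tI))// ler_piMr//.
    exact: normr_cos_le1.
  - by move=> t; apply: cvgM; [exact: continuous_horner|exact: continuous_sinM].
  - move=> t tI; rewrite normrM (le_trans _ (pK t tI))// ler_piMr//.
    exact: normr_sin_le1.
(* The cofactor that remains after differentiating and taking out m factors [1 - 'X ^+ 2]. *)
pose r' : {poly R} := (1 - 'X ^+ 2) * r^`() - 2%:R * m.+1%:R * 'X * r.
have r'E : ((1 - 'X ^+ 2) ^+ m.+1 * r)^`() = (1 - 'X ^+ 2) ^+ m * r'.
  rewrite derivM deriv_exp derivB derivXn -polyC1 derivC polyC1 sub0r expr1 /r'.
  rewrite -mulr_natl (exprS _ m); ring.
have [K K0 IH] := IHm r'.
exists K => // a rho w rho0 p.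
have ab : a - rho < a + rho by lra.
have rho_neq0 : rho != 0 by rewrite gt_eqF.
have pa : p.[a - rho] = 0.
  rewrite horner_rescale (_ : _ / _ = -1); last by rewrite addrAC subrr sub0r mulNr divff.
  by rewrite !hornerE sqrrN expr1n subrr expr0n mul0r.
have pb : p.[a + rho] = 0.
  rewrite horner_rescale (_ : _ / _ = 1); last by rewrite addrAC subrr add0r divff.
  by rewrite !hornerE expr1n subrr expr0n mul0r.
have p'E t : p^`().[t] = rho^-1 * (((1 - 'X ^+ 2) ^+ m * r') \Po rescale a rho).[t].
  by rewrite deriv_rescale r'E hornerZ.
have [Hc Hs] := IH a rho w rho0.
have step (g : R -> R) (x : R) : continuous g ->
    w * x = (\int[mu]_(t in `[a - rho, a + rho]) (p^`().[t] * g t)) \/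
    w * x = (- \int[mu]_(t in `[a - rho, a + rho]) (p^`().[t] * g t)) ->
    `|rho * w| ^+ m * `|\int[mu]_(t in `[a - rho, a + rho])
      ((((1 - 'X ^+ 2) ^+ m * r') \Po rescale a rho).[t] * g t)| <= K * rho ->
    `|rho * w| ^+ m.+1 * `|x| <= K * rho.
  move=> cg wx; apply: le_trans.
  rewrite exprSr -mulrA ler_wpM2l// ?exprn_ge0// -normrM -mulrA.
  have E : \int[mu]_(t in `[a - rho, a + rho]) (p^`().[t] * g t) =
      rho^-1 * \int[mu]_(t in `[a - rho, a + rho])
      ((((1 - 'X ^+ 2) ^+ m * r') \Po rescale a rho).[t] * g t).
    rewrite -RintegralZl//.
      by apply: eq_Rintegral => t _; rewrite p'E mulrA.
    apply: integrable_itv => t; apply: cvgM; first exact: continuous_horner.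
    exact: cg.
  by case: wx => ->; rewrite E ?mulrN ?normrN mulVKf.
split.
- apply: step Hs; first exact: continuous_sinM.
  by right; exact: horner_cos_parts.
- apply: step Hc; first exact: continuous_cosM.
  by left; exact: horner_sin_parts.
Qed.

(** For m = 0 the power is constantly 1, so the support lies in [a - rho, a + rho] only for a
    positive exponent; hence the [m.+1] in what follows. *)
Definition bump1 m a rho t : R := Num.max 0 (1 - ((t - a) / rho) ^+ 2) ^+ m.

Lemma continuous_bump m a rho : continuous (bump1 m a rho).
Proof.
move=> t; apply: (@continuous_comp _ _ _
  (fun t => Num.max 0 (1 - ((t - a) / rho) ^+ 2)) (fun y => y ^+ m)).
  apply: continuous_max; first exact: cst_continuous.
  apply: cvgB; first exact: cvg_cst.
  apply: (@continuous_comp _ _ _ (fun t => (t - a) / rho) (fun y => y ^+ 2)).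
    apply: cvgM; last exact: cvg_cst.
    by apply: cvgB; [exact: cvg_id|exact: cvg_cst].
  exact: exprn_continuous.
exact: exprn_continuous.
Qed.

Lemma measurable_bump m a rho : measurable_fun setT (bump1 m a rho).
Proof. by apply: continuous_measurable_fun; exact: continuous_bump. Qed.

Lemma bump_ge0 m a rho t : 0 <= bump1 m a rho t.
Proof. by rewrite exprn_ge0// le_max lexx. Qed.

Lemma bump_le1 m a rho t : bump1 m a rho t <= 1.
Proof.
rewrite exprn_ile1// ?le_max ?lexx// ge_max ler01/=.
by have := sqr_ge0 ((t - a) / rho); lra.
Qed.

Lemma bump_center m a rho : bump1 m a rho a = 1.
Proof. by rewrite /bump1 subrr mul0r expr0n subr0 (max_r ler01) expr1n. Qed.

Lemma bump_eq0 m a rho t : 0 < rho -> rho <= `|t - a| -> bump1 m.+1 a rho t = 0.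
Proof.
move=> rho0 h; rewrite /bump1 max_l ?expr0n// subr_le0 -[leLHS](expr1n _ 2).
rewrite -[leRHS]real_normK ?num_real// ler_pXn2r ?nnegrE//.
by rewrite normrM normfV (gtr0_norm rho0) ler_pdivlMr// mul1r.
Qed.

Lemma bump_horner m a rho t : 0 < rho -> t \in `[a - rho, a + rho] ->
  bump1 m a rho t = ((1 - 'X ^+ 2) ^+ m \Po rescale a rho).[t].
Proof.
move=> rho0 tI; rewrite horner_rescale !hornerE /bump1 max_r//.
by rewrite subr_ge0 -real_normK ?num_real// exprn_ile1// itv_rescale.
Qed.

Lemma bump_patch m a rho : 0 < rho ->
  bump1 m.+1 a rho = (horner ((1 - 'X ^+ 2) ^+ m.+1 \Po rescale a rho))
                    \_ `[a - rho, a + rho].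
Proof.
move=> rho0; apply/funext => t; rewrite patchE; case: ifPn => tI.
  by rewrite bump_horner//; move: tI; rewrite inE.
apply: bump_eq0 => //; move: tI; rewrite notin_setE/= in_itv/= => /negP.
by rewrite negb_and -!ltNge => /orP[]?; rewrite ler_normr; apply/orP; lra.
Qed.

Lemma integrable_bump m a rho : 0 < rho ->
  mu.-integrable setT (EFin \o bump1 m.+1 a rho).
Proof.
move=> rho0; rewrite bump_patch// -restrict_EFin -integrable_mkcond//.
by apply: integrable_itv; exact: continuous_horner.
Qed.

Lemma Rintegral_bumpM m a rho (g : R -> R) : 0 < rho ->
  \int[mu]_t (bump1 m.+1 a rho t * g t) = \int[mu]_(t in `[a - rho, a + rho])
    (((1 - 'X ^+ 2) ^+ m.+1 \Po rescale a rho).[t] * g t).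
Proof.
move=> rho0; rewrite [RHS]Rintegral_mkcond; apply: eq_Rintegral => t _.
by rewrite bump_patch// !patchE; case: ifPn => // _; rewrite mul0r.
Qed.

(** The sum 1 + y is at most twice the larger of 1 and y. This merges a bound without decay and a
    bound with full decay into a single one. *)
Lemma expr1D_le m (y : R) : 0 <= y -> (1 + y) ^+ m <= 2 ^+ m * (1 + y ^+ m).
Proof.
move=> y0; have [y1|y1] := leP y 1.
  apply: (@le_trans _ _ (2 ^+ m)).
    by rewrite lerXn2r ?nnegrE//; lra.
  by rewrite ler_peMr ?exprn_ge0// lerDl exprn_ge0.
apply: (@le_trans _ _ ((2 * y) ^+ m)).
  by rewrite lerXn2r ?nnegrE//; lra.
by rewrite exprMn ler_wpM2l ?exprn_ge0// lerDr.
Qed.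

Lemma sqr_bump_fourier_le m : exists2 K : R, 0 < K &
  forall a rho w, 0 < rho ->
    cos_int (bump1 m.+1 a rho) w ^+ 2 + sin_int (bump1 m.+1 a rho) w ^+ 2 <=
    K * rho ^+ 2 / (1 + (rho * w) ^+ 2) ^+ m.+1.
Proof.
(* The same bump is estimated twice: with no integration by parts, all factors being put into the
   cofactor, and with m + 1 of them. *)
have [K0 K00 H0] := horner_fourier_decay 0 ((1 - 'X ^+ 2) ^+ m.+1).
have [K1 K10 H1] := horner_fourier_decay m.+1 1.
(* [L] dominates both constants and the summand 1 makes it positive. In the constant below, 4 is 2
   for the two bounds times 2 for cosine and sine. *)
pose L := K0 + K1 + 1.
exists (2 ^+ m.+1 * (4 * L ^+ 2)).
  by rewrite mulr_gt0 ?exprn_gt0// mulr_gt0// exprn_gt0// /L; lra.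
move=> a rho w rho0; rewrite /cos_int /sin_int !Rintegral_bumpM//.
have {H0}[] := H0 a rho w rho0; have {H1}[] := H1 a rho w rho0.
rewrite !expr0 !mul1r mulr1.
set c := Rintegral _ _ _; set s := Rintegral _ _ _ => Hc Hs Hc0 Hs0.
rewrite ler_pdivlMr; last by rewrite exprn_gt0// ltr_wpDr ?sqr_ge0.
set x := rho * w in Hc Hs *.
have B z : `|z| <= K0 * rho -> `|x| ^+ m.+1 * `|z| <= K1 * rho ->
    z ^+ 2 * (1 + x ^+ 2) ^+ m.+1 <= 2 ^+ m.+1 * (2 * L ^+ 2) * rho ^+ 2.
  move=> z0 z1.
  have L0 (K y : R) : 0 <= K -> K <= L -> 0 <= y -> y <= K * rho -> y ^+ 2 <= L ^+ 2 * rho ^+ 2.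
    move=> hK KL y0 yK; rewrite -exprMn lerXn2r ?nnegrE//.
      by rewrite mulr_ge0 ?(ltW rho0)// (le_trans hK).
    by rewrite (le_trans yK)// ler_wpM2r// ltW.
  have z0' : z ^+ 2 <= L ^+ 2 * rho ^+ 2.
    rewrite -real_normK ?num_real//; apply: (L0 K0) => //.
    by rewrite /L; lra.
  have z1' : (x ^+ 2) ^+ m.+1 * z ^+ 2 <= L ^+ 2 * rho ^+ 2.
    rewrite -(real_normK (num_real x)) -(real_normK (num_real z)) exprAC -exprMn.
    by apply: (L0 K1) => //; rewrite /L; lra.
  have := ler_wpM2l (sqr_ge0 z) (expr1D_le m.+1 (sqr_ge0 x)).
  move/le_trans; apply.
  rewrite (_ : z ^+ 2 * _ = 2 ^+ m.+1 * (z ^+ 2 + (x ^+ 2) ^+ m.+1 * z ^+ 2)); last by ring.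
  rewrite -!mulrA ler_wpM2l ?exprn_ge0//; lra.
rewrite mulrDl; have := B _ Hc0 Hc; have := B _ Hs0 Hs; lra.
Qed.

(** * The integral of 1 / (1 + (rho t)^2) *)

Lemma measurable_oneDsqrV_scale rho :
  measurable_fun setT (fun t : R => (1 + (rho * t) ^+ 2)^-1).
Proof.
apply: continuous_measurable_fun => t.
apply: (@continuous_comp _ _ _ ( *%R rho) (fun t => (oneDsqr t)^-1)).
  exact: mulrl_continuous.
exact: continuous_oneDsqrV.
Qed.

Lemma integral_oneDsqr_scale rho : 0 < rho ->
  (\int[mu]_t ((1 + (rho * t) ^+ 2)^-1)%:E = (pi / rho)%:E)%E.
Proof.
move=> rho0.
(* By symmetry this is twice the integral over the half-line, which is pi / 2; the substitution of
   [rho * t] for t then gives the general case. *)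
have E : (\int[mu]_t ((oneDsqr t)^-1)%:E = pi%:E)%E.
  rewrite ge0_symfun_integralT.
  - rewrite -set_itvcy integral0y_oneDsqr -EFinM; congr EFin; lra.
  - by move=> t; rewrite invr_ge0 (le_trans ler01 (oneDsqr_ge1 _)).
  - exact: continuous_oneDsqrV.
  - by move=> t /=; rewrite /oneDsqr sqrrN.
have dF := is_derive_mull rho.
have dE : (( *%R rho)^`())%classic = cst rho.
  by apply/funext => t; rewrite derive1E; exact: derive_val.
have {}E : ((\int[mu]_t ((1 + (rho * t) ^+ 2)^-1)%:E) * rho%:E = pi%:E)%E.
  rewrite -E (@increasing_ge0_integration_by_substitutionT _ ( *%R rho)
    (fun t => (oneDsqr t)^-1)).
  + rewrite -ge0_integralZr//; last 3 first.
    * by apply/measurable_EFinP; exact: measurable_oneDsqrV_scale.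
    * by move=> t _; rewrite lee_fin invr_ge0 (le_trans ler01 (oneDsqr_ge1 _)).
    * by rewrite lee_fin ltW.
    by apply: eq_integral => t _; rewrite dE /= -EFinM.
- by move=> x y; rewrite ltr_pM2l.
- by rewrite dE; exact: cst_continuous.
- by rewrite dE; exact: is_cvg_cst.
- by rewrite dE; exact: is_cvg_cst.
- by move=> t; exact: ex_derive.
- by apply: gt0_cvgMrNy => //; exact: cvg_id.
- by apply: gt0_cvgMry => //; exact: cvg_id.
- exact: continuous_oneDsqrV.
- by move=> t; rewrite invr_ge0 (le_trans ler01 (oneDsqr_ge1 _)).
have : (((rho^-1)%:E * pi%:E) = (pi / rho)%:E :> \bar R)%E by rewrite -EFinM mulrC.
by rewrite -E muleC -muleA -EFinM divff ?gt_eqF// mule1.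
Qed.
End bump.

(** * Sobolev norm of the tensor bumps *)

Section sobolev_bump.
Variables (R : realType) (d : nat).
Local Notation mu := (@lebesgue_measure R).
Local Notation leb := (lebesgue_rV R d).
Implicit Types x w : 'rV[R]_d.

Lemma enorm_sqr x : enorm x ^+ 2 = \sum_(i < d) x 0 i ^+ 2.
Proof.
rewrite /enorm sqr_sqrtr; first by apply: eq_bigr.
by apply: sumr_ge0 => i _; exact: sqr_ge0.
Qed.

Lemma enorm_le_sum x : enorm x <= \sum_(i < d) `|x 0 i|.
Proof.
rewrite -(@ler_pXn2r _ 2) ?nnegrE ?sqrtr_ge0//; last exact: sumr_ge0.
rewrite enorm_sqr.
suff [] : \sum_(i < d) x 0 i ^+ 2 <= (\sum_(i < d) `|x 0 i|) ^+ 2 /\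
    0 <= \sum_(i < d) `|x 0 i| by [].
elim/big_rec2: _ => [|i a b _ [h b0]]; first by rewrite expr0n.
split; last exact: addr_ge0.
rewrite sqrrD real_normK ?num_real//.
by have := mulr_ge0 (normr_ge0 (x 0 i)) b0; lra.
Qed.

Definition bump_rV m x rho : 'rV[R]_d -> R := tensor (fun i => bump1 m (x 0 i) rho).

Lemma bump_rV_ge0 m x rho y : 0 <= bump_rV m x rho y.
Proof. by apply: prodr_ge0 => i _; exact: bump_ge0. Qed.

Lemma bump_rV_le1 m x rho y : bump_rV m x rho y <= 1.
Proof.
by rewrite /bump_rV /tensor; apply: prodr_ile1 => i _; rewrite bump_ge0 bump_le1.
Qed.

Lemma bump_rV_center m x rho : bump_rV m x rho x = 1.
Proof. by rewrite /bump_rV /tensor big1// => i _; rewrite bump_center. Qed.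

Lemma bump_rV_neq0 m x rho y : 0 < rho -> bump_rV m.+1 x rho y != 0 ->
  forall i, `|y 0 i - x 0 i| < rho.
Proof.
move=> rho0 /prodf_neq0 h i; rewrite ltNge; apply/negP => hi.
by have := h i isT; rewrite bump_eq0// eqxx.
Qed.

Lemma integrable_bump_rV m x rho : 0 < rho ->
  leb.-integrable setT (EFin \o bump_rV m.+1 x rho).
Proof. by move=> rho0; apply: integrable_tensor => i; exact: integrable_bump. Qed.

Lemma measurable_bump_rV m x rho : measurable_fun setT (bump_rV m x rho).
Proof. by apply: measurable_tensor => i; exact: measurable_bump. Qed.

(** The values lie between 0 and 1, so the square is dominated by the integrable bump itself. *)
Lemma Lfun2_bump_rV m x rho : 0 < rho -> bump_rV m.+1 x rho \in Lfun leb 2%:E.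
Proof.
move=> rho0; rewrite inE; apply/andP; split; rewrite inE/=.
  exact: measurable_bump_rV.
rewrite /finite_norm unlock; apply: poweR_lty.
have /integrableP[_] := integrable_bump_rV m x rho0; apply: le_lt_trans.
have mF := measurable_bump_rV m.+1 x rho.
have E y : (`|(EFin \o bump_rV m.+1 x rho) y| `^ 2)%E = (bump_rV m.+1 x rho y ^+ 2)%:E.
  have -> : `|(EFin \o bump_rV m.+1 x rho) y|%E = (bump_rV m.+1 x rho y)%:E.
    by rewrite gee0_abs ?lee_fin ?bump_rV_ge0.
  by rewrite poweR_EFin powR_mulrn ?bump_rV_ge0.
under eq_integral do rewrite E.
apply: ge0_le_integral => //.
- by move=> y _; rewrite lee_fin sqr_ge0.
- by apply/measurable_EFinP; exact: measurable_funX.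
- by apply/measurable_EFinP; exact: measurableT_comp.
move=> y _ /=; rewrite lee_fin ger0_norm ?bump_rV_ge0//.
by rewrite expr2 ler_piMr ?bump_rV_ge0 ?bump_rV_le1.
Qed.

Let kappa : R := (2 * pi) `^ (- (d%:R / 2)).

Lemma Re_fourier_integral (f : 'rV[R]_d -> R) w :
  complex.Re (fourier_integral f w) = kappa * cos_int_rV f w.
Proof. by rewrite /fourier_integral /= mul0r subr0. Qed.

Lemma Im_fourier_integral (f : 'rV[R]_d -> R) w :
  complex.Im (fourier_integral f w) = - (kappa * sin_int_rV f w).
Proof. by rewrite /fourier_integral /= mul0r addr0 mulrN. Qed.

(** The bump has bounded support, so its truncations to large balls equal it and the L^2 distance in
    [is_fourier] is eventually 0. *)
Lemma is_fourier_bump_rV m x rho : 0 < rho ->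
  is_fourier (bump_rV m.+1 x rho) (fourier_integral (bump_rV m.+1 x rho)).
Proof.
move=> rho0; have [mC mS] := measurable_fourier_tensor
  (fun i => integrable_bump m (x 0 i) rho0).
split.
- exact: Lfun2_bump_rV.
- under eq_fun do rewrite Re_fourier_integral.
  exact: (measurable_funM (measurable_cst _) mC).
- under eq_fun do rewrite Im_fourier_integral.
  exact: (measurable_funN (measurable_funM (measurable_cst _) mS)).
- apply: cvg_near_cst; near=> r.
  have -> : bump_rV m.+1 x rho \_ [set y | enorm y <= r] = bump_rV m.+1 x rho.
    apply/funext => y; rewrite patchE; case: ifPn => //; rewrite notin_setE/= => yr.
    apply/esym/eqP/negPn/negP => /(bump_rV_neq0 rho0) h; apply: yr.
    apply: (le_trans (enorm_le_sum y)).
    (* On the support the i-th coordinate is within [rho] of that of [x]; the sum of these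
       coordinate bounds is a sufficient radius. *)
    apply: (@le_trans _ _ (\sum_(i < d) (rho + `|x 0 i|))).
      apply: ler_sum => i _; have := ltW (h i).
      by have := ler_normD (y 0 i - x 0 i) (x 0 i); rewrite subrK; lra.
    by near: r; apply: nbhs_pinfty_ge; rewrite num_real.
  under eq_integral do rewrite subrr /sqnormc/= expr0n/= addr0.
  exact: integral0.
Unshelve. all: by end_near. Qed.

Lemma sqnormc_fourier_bump m x rho w : 0 < rho ->
  sqnormc (fourier_integral (bump_rV m.+1 x rho) w) =
  kappa ^+ 2 * \prod_(i < d) (cos_int (bump1 m.+1 (x 0 i) rho) (w 0 i) ^+ 2 +
                              sin_int (bump1 m.+1 (x 0 i) rho) (w 0 i) ^+ 2).
Proof.
move=> rho0; rewrite /sqnormc Re_fourier_integral Im_fourier_integral.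
rewrite -sqr_fourier_tensor; last by move=> i; exact: integrable_bump.
by rewrite sqrrN !exprMn mulrDr.
Qed.

(** Expanding the product of the factors 1 + a_i gives at least 1 plus the sum of the a_i. The
    prefactor then leaves (D / rho)^2 + D^2 |w|^2, and both [D / rho] and [D] are at least 1. *)
Lemma oneD_enorm_le (D rho : R) w : 1 <= D -> 0 < rho -> rho <= D ->
  1 + enorm w ^+ 2 <= (D / rho) ^+ 2 * \prod_(i < d) (1 + (rho * w 0 i) ^+ 2).
Proof.
move=> D1 rho0 rhoD.
have h : 1 + \sum_(i < d) (rho * w 0 i) ^+ 2 <= \prod_(i < d) (1 + (rho * w 0 i) ^+ 2).
  suff [] : 1 + \sum_(i < d) (rho * w 0 i) ^+ 2 <= \prod_(i < d) (1 + (rho * w 0 i) ^+ 2)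
    /\ 0 <= \sum_(i < d) (rho * w 0 i) ^+ 2 by [].
  elim/big_ind2: _ => [|b a b' a' [h1 h2] [h3 h4]|i _].
  - by rewrite addr0.
  - split; last exact: addr_ge0.
    apply: (@le_trans _ _ ((1 + a) * (1 + a'))); first by nra.
    by apply: ler_pM => //; lra.
  - by split => //; exact: sqr_ge0.
apply: le_trans (ler_wpM2l (sqr_ge0 _) h); rewrite enorm_sqr.
under [X in _ <= _ * (1 + X)]eq_bigr do rewrite exprMn.
rewrite -mulr_sumr mulrDr mulr1 mulrA -exprMn divfK ?gt_eqF//.
apply: lerD.
  by rewrite expr_ge1// ?divr_ge0//; [rewrite ler_pdivlMr// mul1r|lra|lra].
rewrite ler_peMl ?expr_ge1//; last by lra.
by apply: sumr_ge0 => i _; exact: sqr_ge0.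
Qed.

Lemma integral_prod_oneDsqr (rho : R) : 0 < rho ->
  (\int[leb]_w (\prod_(i < d) (1 + (rho * w 0 i) ^+ 2)^-1)%:E)%E = ((pi / rho) ^+ d)%:E.
Proof.
move=> rho0; pose g (i : 'I_d) (t : R) := (1 + (rho * t) ^+ 2)^-1.
have g0 t : 0 <= (1 + (rho * t) ^+ 2)^-1 by rewrite invr_ge0 addr_ge0// sqr_ge0.
have mg := measurable_oneDsqrV_scale rho.
have ig i : mu.-integrable setT (EFin \o g i).
  apply/integrableP; split; first exact/measurable_EFinP.
  apply: le_lt_trans (ltry (pi / rho)); rewrite -integral_oneDsqr_scale//.
  rewrite le_eqVlt; apply/orP; left; apply/eqP.
  by apply: eq_integral => t _ /=; rewrite ger0_norm /g ?g0.
have := Rintegral_tensor ig; rewrite /Rintegral /tensor /g => E.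
rewrite -[LHS]fineK; last exact: (integrable_fin_num _ (integrable_tensor ig)).
rewrite E; congr EFin.
by under eq_bigr do rewrite integral_oneDsqr_scale//; rewrite prodr_const card_ord.
Qed.

(** With P the product of the 1 + (rho w_i)^2, the squared transform decays like P^-(m+1), while the
    weight costs at most P^m because [tau <= m%:R]. The remaining P^-1 is integrable, which is why
    the bump has exponent [m.+1]. *)
Lemma sobolev_norm_bump (tau D : R) m : 0 <= tau -> tau <= m%:R -> 1 <= D ->
  exists2 C : R, 0 < C & forall x rho, 0 < rho -> rho <= D ->
    (sobolev_norm tau (bump_rV m.+1 x rho) <= (C * rho `^ (d%:R / 2 - tau))%:E)%E.
Proof.
move=> tau0 taum D1.
have [K K0 HK] := sqr_bump_fourier_le R m.
have D0 : 0 < D by lra.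
have kappa0 : 0 < kappa by rewrite powR_gt0// mulr_gt0// pi_gt0.
(* The part of the final bound that is free of [rho]; the square root comes from the norm. *)
pose B : R := kappa ^+ 2 * (K * pi) ^+ d * D `^ (2 * tau).
have B0 : 0 < B.
  by rewrite !mulr_gt0 ?exprn_gt0 ?powR_gt0// mulr_gt0// pi_gt0.
exists (B `^ 2^-1); first by rewrite powR_gt0.
move=> x rho rho0 rhoD.
pose P w := \prod_(i < d) (1 + (rho * w 0 i) ^+ 2).
have P1 w : 1 <= P w.
  by rewrite /P; elim/big_ind : _ => // [a b|i _]; [exact: mulr_ege1|rewrite lerDl sqr_ge0].
have P0 w : 0 < P w by apply: lt_le_trans (P1 w).
pose A : R := kappa ^+ 2 * (K * rho ^+ 2) ^+ d * (D / rho) `^ (2 * tau).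
have A0 : 0 <= A.
  rewrite !mulr_ge0 ?exprn_ge0 ?powR_ge0// ?(ltW kappa0)// mulr_ge0// ?exprn_ge0//; lra.
(* Count of the powers of [rho]: 2d from the transforms, -2 tau from the weight and -d from the
   integral of 1 / P. *)
have AB : A * (pi / rho) ^+ d = B * rho `^ (d%:R - 2 * tau).
  have e1 : (D / rho) `^ (2 * tau) = D `^ (2 * tau) * rho `^ (- (2 * tau)).
    rewrite powRM ?invr_ge0 ?ltW//; congr *%R.
    by rewrite -powR_inv1 ?ltW// -powRrM mulN1r.
  have e2 : rho `^ (d%:R - 2 * tau) = rho ^+ d * rho `^ (- (2 * tau)).
    by rewrite powRD ?powR_mulrn ?ltW// (gt_eqF rho0) implybT.
  have e3 : (K * rho ^+ 2) ^+ d * (pi / rho) ^+ d = (K * pi) ^+ d * rho ^+ d.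
    by rewrite -!exprMn; congr (_ ^+ _); field; rewrite gt_eqF.
  transitivity (kappa ^+ 2 * ((K * rho ^+ 2) ^+ d * (pi / rho) ^+ d) *
      (D `^ (2 * tau) * rho `^ (- (2 * tau)))).
    by rewrite /A e1; ring.
  by rewrite e2 e3 /B; ring.
have bound w : (1 + enorm w ^+ 2) `^ tau *
    sqnormc (fourier_integral (bump_rV m.+1 x rho) w) <= A * (P w)^-1.
  have h1 : (1 + enorm w ^+ 2) `^ tau <= (D / rho) `^ (2 * tau) * P w ^+ m.
    apply: (@le_trans _ _ (((D / rho) ^+ 2 * P w) `^ tau)).
      apply: ge0_ler_powR; rewrite ?nnegrE//.
      - by rewrite addr_ge0// sqr_ge0.
      - by rewrite mulr_ge0 ?sqr_ge0// ltW.
      - exact: oneD_enorm_le.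
    rewrite powRM ?sqr_ge0//; last exact: ltW.
    have Drho : 0 <= D / rho by rewrite divr_ge0 ?ltW.
    rewrite powRrM [_ `^ 2]powR_mulrn// ler_wpM2l ?powR_ge0//.
    by rewrite -powR_mulrn ?(ltW (P0 _))// ler_powR.
  have h2 : sqnormc (fourier_integral (bump_rV m.+1 x rho) w) <=
      kappa ^+ 2 * ((K * rho ^+ 2) ^+ d / P w ^+ m.+1).
    rewrite sqnormc_fourier_bump// ler_wpM2l ?sqr_ge0//.
    apply: (@le_trans _ _ (\prod_(i < d) (K * rho ^+ 2 / (1 + (rho * w 0 i) ^+ 2) ^+ m.+1))).
      by apply: ler_prod => i _; rewrite addr_ge0 ?sqr_ge0//= HK.
    rewrite big_split/= prodr_const card_ord ler_wpM2l//.
      by rewrite exprn_ge0// mulr_ge0 ?sqr_ge0// ltW.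
    by rewrite prodfV -prodrXl.
  apply: le_trans (ler_pM _ _ h1 h2) _.
  - exact: powR_ge0.
  - by rewrite addr_ge0 ?sqr_ge0.
  rewrite (exprS (P w)) /A le_eqVlt; apply/orP; left; apply/eqP.
  have Pm0 : P w ^+ m != 0 by rewrite expf_neq0// gt_eqF.
  move: ((D / rho) `^ _) ((K * _) ^+ _) (P w ^+ m) Pm0 => X Y Z Z0.
  by field; rewrite Z0 gt_eqF.
(* The infimum is bounded by its value at the explicit transform. *)
rewrite /sobolev_norm; apply: ereal_inf_le.
exists ((\int[leb]_w ((1 + enorm w ^+ 2) `^ tau *
   sqnormc (fourier_integral (bump_rV m.+1 x rho) w))%:E) `^ 2^-1)%E.
  by exists (fourier_integral (bump_rV m.+1 x rho)) => //; exact: is_fourier_bump_rV.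
have -> : (B `^ 2^-1 * rho `^ (d%:R / 2 - tau))%:E =
    ((A * (pi / rho) ^+ d)%:E `^ 2^-1)%E.
  rewrite AB poweR_EFin; congr EFin.
  rewrite powRM ?ltW// ?powR_gt0// -powRrM; congr (_ * _ `^ _).
  by field.
apply: gt0_ler_poweR => //.
- rewrite in_itv/= leey andbT integral_ge0// => w _.
  by rewrite lee_fin mulr_ge0 ?powR_ge0// addr_ge0 ?sqr_ge0.
- by rewrite in_itv/= leey andbT lee_fin mulr_ge0 ?exprn_ge0// divr_ge0 ?pi_ge0// ltW.
have mPV : measurable_fun setT (fun w => (P w)^-1).
  rewrite (_ : (fun w => (P w)^-1) = tensor (fun _ t => (1 + (rho * t) ^+ 2)^-1)).
    by apply: measurable_tensor => _; exact: measurable_oneDsqrV_scale.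
  by apply/funext => w; rewrite /P /tensor prodfV.
have [_ mRe mIm _] := is_fourier_bump_rV m x rho0.
apply: (@le_trans _ _ (\int[leb]_w (A%:E * (P w)^-1%:E))%E).
  apply: ge0_le_integral => //.
  - by move=> w _; rewrite lee_fin mulr_ge0 ?powR_ge0// addr_ge0 ?sqr_ge0.
  - apply/measurable_EFinP; apply: measurable_funM.
      apply: (measurableT_comp (measurable_powR tau)); apply: measurable_funD => //.
      under eq_fun do rewrite enorm_sqr.
      by apply: measurable_sum => i; apply: measurable_funX; exact: measurable_coord.
    exact: (measurable_funD (measurable_funX _ mRe) (measurable_funX _ mIm)).
  - by apply/measurable_EFinP; apply: measurable_funM.
  - by move=> w _; rewrite -EFinM lee_fin bound.
rewrite ge0_integralZl//; last 2 first.
- by apply/measurable_EFinP.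
- by move=> w _; rewrite lee_fin invr_ge0 ltW.
under eq_integral do rewrite /P -prodfV.
by rewrite integral_prod_oneDsqr.
Qed.
End sobolev_bump.

(** * Almost everywhere statements on the closure of an open set *)

Section density.
Variables (R : realType) (d : nat).
Local Notation mu := (@lebesgue_measure R).
Local Notation leb := (lebesgue_rV R d).

(** Balls of the maximum norm are cubes, so the indicator of the ball is a tensor product of
    indicators of intervals of length 2 rho. *)
Lemma lebesgue_rV_ball_le (x : 'rV[R]_d) (rho : R) (A : set 'rV[R]_d) : 0 < rho ->
  measurable A -> ball x rho `<=` A -> (((2 * rho) ^+ d)%:E <= leb A)%E.
Proof.
move=> rho0 mA bA.
pose I i := `](x 0 i - rho), (x 0 i + rho)[%classic : set R.
pose g i : R -> R := \1_(I i).
have muI i : mu (I i) = (2 * rho)%:E.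
  rewrite /I lebesgue_measure_itv/= lte_fin ifT; last by lra.
  by rewrite -EFinD; congr EFin; lra.
have ig i : mu.-integrable setT (EFin \o g i).
  apply/integrableP; split.
    by apply/measurable_EFinP; apply: measurable_indic; exact: measurable_itv.
  apply: le_lt_trans (ltry (2 * rho)); rewrite -(muI i) -(setIT (I i)).
  rewrite -integral_indic//; last exact: measurable_itv.
  rewrite le_eqVlt; apply/orP; left; apply/eqP.
  by apply: eq_integral => t _ /=; rewrite ger0_norm.
have E : \int[leb]_y tensor g y = (2 * rho) ^+ d.
  rewrite Rintegral_tensor//.
  rewrite -[in RHS](card_ord d) -prodr_const; apply: eq_bigr => i _.
  rewrite /Rintegral /g integral_indic ?setIT; last 2 first.
  - by [].
  - exact: measurable_itv.
  exact: (congr1 fine (muI i)).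
have g0 y : 0 <= tensor g y by apply: prodr_ge0.
rewrite -E /Rintegral fineK; last exact: (integrable_fin_num _ (integrable_tensor ig)).
rewrite -[in leRHS](setIT A) -integral_indic//.
apply: ge0_le_integral => //.
- by move=> y _; rewrite lee_fin.
- by have /integrableP[] := integrable_tensor ig.
- by apply/measurable_EFinP; exact: measurable_indic.
move=> y _; rewrite lee_fin.
have [->//|/prodf_neq0 gy] := eqVneq (tensor g y) 0.
have Ay : A y.
  apply: bA; split=> // i j; rewrite (ord1 i); move: (gy j isT); rewrite /g indicE.
  case: (boolP (_ \in _)); last by rewrite eqxx.
  rewrite inE /I/= in_itv/= => /andP[h1 h2] _.
  by rewrite /ball/= ltr_norml; apply/andP; split; lra.
rewrite indicE mem_set//; apply: Num.Theory.prodr_ile1 => i _.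
by rewrite /g indicE; case: (_ \in _); rewrite ?lexx ?ler01.
Qed.

(** Otherwise a null set would contain a ball, which has positive measure. *)
Lemma ae_ball (P : 'rV[R]_d -> Prop) (x : 'rV[R]_d) (rho : R) : 0 < rho ->
  {ae leb, forall y, P y} -> exists2 y, ball x rho y & P y.
Proof.
move=> rho0 [A [mA A0 PA]]; apply: contrapT => h.
have : ball x rho `<=` A by move=> y xy; apply: PA => Py; apply: h; exists y.
move/(lebesgue_rV_ball_le rho0 mA); rewrite A0 lee_fin.
by rewrite leNgt exprn_gt0// mulr_gt0.
Qed.

(** Arbitrarily close to any point of [Omega] there is a ball inside [Omega], and this ball contains
    a point where the inequality holds; continuity carries it to the given point. *)
Lemma ae_le_within (Omega : set 'rV[R]_d) (g : 'rV[R]_d -> R) (c : R) :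
  closure (interior Omega) = Omega ->
  {within Omega, continuous g} ->
  {ae leb, forall x, Omega x -> g x <= c} ->
  forall x, Omega x -> g x <= c.
Proof.
move=> cl /subspace_continuousP cg ae x Ox; apply/ler_addgt0Pr => e e0.
have := cg x Ox; move/cvgrPdist_lt => /(_ e e0).
rewrite /within/= -nbhs_ballE => -[r /= r0 xr].
have [z [zi xz]] : interior Omega `&` ball x r !=set0.
  by move: Ox; rewrite -{1}cl; apply; exact: nbhsx_ballx.
have : nbhs z (interior Omega `&` ball x r).
  apply: filterI.
    by apply: open_nbhs_nbhs; split => //; exact: open_interior.
  apply: open_nbhs_nbhs; split => //.
  exact: ball_open.
rewrite -nbhs_ballE => -[s /= s0 zs].
have [y zy yc] := ae_ball z s0 ae.
have [yi xy] := zs _ zy.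
have Oy : Omega y by exact: interior_subset.
have := xr _ xy Oy; have := yc Oy; rewrite /from_subspace ltr_distl => ? /andP[? ?].
lra.
Qed.
End density.

(** * Native spaces *)

Section native.
Variables (R : realType) (d : nat) (Omega : set 'rV[R]_d)
  (k : 'rV[R]_d -> 'rV[R]_d -> R) (H : native_space Omega k).
Local Notation V := 'rV[R]_d.
Implicit Types f g h : V -> R.
Local Notation K := (kernel_section Omega k).

Lemma inner_linr (a : R) f g h : carrier H f -> carrier H g -> carrier H h ->
  inner H h (fun x => a * f x + g x) = a * inner H h f + inner H h g.
Proof.
move=> Hf Hg Hh; rewrite inner_sym//; last exact: carrier_lin.
by rewrite inner_lin// ![inner H _ h]inner_sym.
Qed.

Lemma inner0r f : carrier H f -> inner H f (fun=> 0) = 0.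
Proof.
move=> Hf; have H0 := carrier0 H.
have := inner_linr 1 H0 H0 Hf.
have -> : (fun x : V => 1 * 0 + 0) = (fun=> 0 : R) by apply/funext => x; rewrite mulr0 addr0.
by rewrite mul1r => /eqP; rewrite -subr_eq0 opprD addNKr oppr_eq0 => /eqP.
Qed.

Lemma inner_cauchy_schwarz f g : carrier H f -> carrier H g ->
  inner H f g ^+ 2 <= inner H f f * inner H g g.
Proof.
move=> Hf Hg.
(* The squared norm of t f + g, a nonnegative polynomial in t. *)
have q t : 0 <= t ^+ 2 * inner H f f + 2 * t * inner H f g + inner H g g.
  have := inner_ge0 (carrier_lin t Hf Hg).
  rewrite inner_lin ?inner_linr//; last exact: carrier_lin.
  rewrite (inner_sym Hg Hf); lra.
have := inner_ge0 Hf; rewrite le_eqVlt => /predU1P[ff0|ff0].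
  rewrite -ff0 mul0r; have := inner_ge0 Hg.
  have [->|fg0] := eqVneq (inner H f g) 0; first by rewrite expr0n.
  (* Here the polynomial is affine in t, and this t gives it the value -1. *)
  move=> gg0; have := q (- (inner H g g + 1) / (2 * inner H f g)).
  rewrite -ff0 mulr0 add0r.
  rewrite (_ : 2 * _ * _ = - (inner H g g + 1)); last by field.
  by lra.
(* The minimiser of the quadratic polynomial. *)
have := q (- inner H f g / inner H f f).
rewrite (_ : _ + _ = inner H g g - inner H f g ^+ 2 / inner H f f); last first.
  by field; rewrite gt_eqF.
by rewrite subr_ge0 ler_pdivrMr// mulrC.
Qed.

Lemma kernel_sectionE x y : Omega y -> K x y = k y x.
Proof. by move=> Oy; rewrite /kernel_section patchE mem_set. Qed.

(** By the reproducing property f x - f y is the inner product of f with the difference of the two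
    kernel sections, whose squared norm is the second factor; then Cauchy-Schwarz applies. *)
Lemma native_dist_le f x y : carrier H f -> Omega x -> Omega y ->
  (f x - f y) ^+ 2 <= inner H f f * (k x x - k y x - k x y + k y y).
Proof.
move=> Hf Ox Oy.
have Kx := carrier_kernel H Ox; have Ky := carrier_kernel H Oy.
have Kd := carrier_lin (-1) Ky Kx.
have := inner_cauchy_schwarz Hf Kd.
rewrite inner_linr// inner_linr// (inner_reproducing Hf)// (inner_reproducing Hf)//.
rewrite (inner_reproducing Kd)// (inner_reproducing Kd)// !kernel_sectionE//.
move/le_trans => h; rewrite (_ : f x - f y = -1 * f y + f x); last by ring.
by apply: h; rewrite le_eqVlt; apply/orP; left; apply/eqP; ring.
Qed.

Lemma native_continuous Phi f :
  continuous Phi -> translational_invariant Omega k Phi ->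
  carrier H f -> {within Omega, continuous f}.
Proof.
move=> cPhi ti Hf; apply/subspace_continuousP => x Ox.
apply/cvgrPdist_lt => e e0; rewrite /within/=.
(* The bound of [native_dist_le] expressed through [Phi]: it is continuous in y and vanishes at y =
   x. *)
pose G y := inner H f f * (Phi 0 - Phi (y - x) - Phi (x - y) + Phi 0).
have cG : continuous G.
  have c1 : continuous (fun y : V => Phi (y - x)).
    move=> z; apply: (@continuous_comp _ _ _ (fun y : V => y - x) Phi); last exact: cPhi.
    by apply: continuousB; [exact: cvg_id|exact: cst_continuous].
  have c2 : continuous (fun y : V => Phi (x - y)).
    move=> z; apply: (@continuous_comp _ _ _ (fun y : V => x - y) Phi); last exact: cPhi.
    by apply: continuousB; [exact: cst_continuous|exact: cvg_id].
  have cc (c : R) z : (fun=> c) @ nbhs (z : V) --> c.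
    exact: (@cvg_cst _ _ _ _ (nbhs_filter z)).
  move=> z; apply: (@cvgM R V _ (nbhs_filter z) (fun=> inner H f f)); first exact: cc.
  apply: (@cvgD _ R^o V); last exact: cc.
  apply: (@cvgB _ R^o V); last exact: c2.
  by apply: (@cvgB _ R^o V _ _ (fun=> Phi 0)); [exact: cc|exact: c1].
have Gx : G x = 0 by rewrite /G subrr; ring.
move/cvgrPdist_lt : (cG x) => /(_ (e ^+ 2)); rewrite exprn_gt0// => /(_ isT).
apply: filterS => y; rewrite Gx sub0r normrN => Ge Oy.
have := native_dist_le Hf Ox Oy; rewrite !ti// !subrr => fG.
rewrite -(@ltr_pXn2r _ 2) ?nnegrE ?(ltW e0)// real_normK ?num_real//.
by apply: le_lt_trans Ge; apply: le_trans fG _; exact: ler_norm.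
Qed.

Lemma kernel_span_carrier N (X : 'I_N -> V) s : (forall i, Omega (X i)) ->
  kernel_span Omega k X s -> carrier H s.
Proof.
move=> XO [a ->]; elim: N X XO a => [|n IHn] X XO a.
  by under eq_fun do rewrite big_ord0; exact: carrier0.
under eq_fun do rewrite big_ord_recl.
apply: carrier_lin; first exact: carrier_kernel.
exact: (IHn (fun i => X (lift ord0 i)) (fun i => XO _) (fun i => a (lift ord0 i))).
Qed.

Lemma inner_kernel_span N (X : 'I_N -> V) (a : 'I_N -> R) f :
  (forall i, Omega (X i)) -> carrier H f ->
  inner H f (fun y => \sum_(i < N) a i * K (X i) y) = \sum_(i < N) a i * f (X i).
Proof.
move=> XO Hf; elim: N X XO a => [|n IHn] X XO a.
  by rewrite big_ord0; under eq_fun do rewrite big_ord0; exact: inner0r.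
rewrite big_ord_recl; under eq_fun do rewrite big_ord_recl.
rewrite inner_linr//; last 2 first.
- exact: carrier_kernel.
- apply: (@kernel_span_carrier _ (fun i => X (lift ord0 i))) => //.
  by exists (fun i => a (lift ord0 i)).
by rewrite inner_reproducing// (IHn (fun i => X (lift ord0 i))).
Qed.

(** A function vanishing on the points is orthogonal to all kernel sections there, so 0 is a valid
    projection. *)
Lemma orth_proj_eq0 N (X : 'I_N -> V) f : (forall i, Omega (X i)) ->
  carrier H f -> (forall i, f (X i) = 0) ->
  orth_proj H (kernel_span Omega k X) f = fun=> 0.
Proof.
move=> XO Hf fX; rewrite /orth_proj.
have f0 s : kernel_span Omega k X s -> inner H f s = 0.
  move=> [a ->]; rewrite inner_kernel_span//.
  by apply: big1 => i _; rewrite fX mulr0.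
have ex : [set p | is_orth_proj H (kernel_span Omega k X) f p] (fun=> 0).
  split.
    exists (fun=> 0); apply/funext => y.
    by rewrite big1// => i _; rewrite mul0r.
  move=> s Ws; rewrite -[RHS](f0 s Ws); congr (inner H _ s).
  by apply/funext => y /=; rewrite subr0.
(* The chosen projection p lies in the span, so both f and f - p are orthogonal to it; hence p has
   norm 0. *)
have := xgetPex (fun=> 0) (ex_intro _ _ ex); set p := xget _ _ => -[Wp fp].
have Hp := kernel_span_carrier XO Wp.
have := fp _ Wp.
have -> : f \- p = (fun x => -1 * p x + f x).
  by apply/funext => y /=; rewrite mulN1r addrC.
rewrite inner_lin// f0// addr0 mulN1r => /eqP; rewrite oppr_eq0 => /eqP pp.
by apply/funext => y; exact: (inner_eq0 Hp pp).
Qed.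
End native.

(** * Bumps as elements of the native space *)

Section witness.
Variables (R : realType) (d : nat).
Local Notation leb := (lebesgue_rV R d).
Implicit Types (x y : 'rV[R]_d) (Omega : set 'rV[R]_d).

Lemma continuous_bump_rV m x (rho : R) : continuous (bump_rV m x rho).
Proof.
move=> y; rewrite /bump_rV /tensor; elim: (index_enum _) => [|i s IHs].
  under eq_fun do rewrite big_nil.
  exact: (@cvg_cst _ _ _ _ (nbhs_filter y)).
under eq_fun do rewrite big_cons.
apply: (@cvgM R _ _ (nbhs_filter y)); last exact: IHs.
apply: (@continuous_comp _ _ _ (fun z : 'rV[R]_d => z 0 i) (bump1 m (x 0 i) rho)).
  exact: coord_continuous.
exact: continuous_bump.
Qed.

Lemma compact_coord_bound Omega : compact Omega ->
  exists B : R, forall x i, Omega x -> `|x 0 i| <= B.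
Proof.
move=> /compact_bounded[M [_ HM]]; exists (`|M| + 1) => x i Ox.
have /(HM _)/(_ x Ox) : M < `|M| + 1 by rewrite ltr_pwDr// ler_norm.
apply: le_trans; rewrite [leRHS]mx_normrE.
exact: (le_bigmax _ (fun ij : 'I_1 * 'I_d => `|x ij.1 ij.2|) (0, i)).
Qed.

(** Where the bump is nonzero all d coordinate differences are below [rho], so the Euclidean
    distance is below d rho; strictness of the summed inequality uses [0 < d]. *)
Lemma bump_rV_eq0 m x (rho : R) y : (0 < d)%N -> 0 < rho ->
  d%:R * rho <= enorm (x - y) -> bump_rV m.+1 x rho y = 0.
Proof.
move=> d0 rho0 xy; apply/eqP/negPn/negP => /(bump_rV_neq0 rho0) h.
move: xy; rewrite leNgt => /negP; apply.
apply: le_lt_trans (enorm_le_sum _) _.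
rewrite mulr_natl -[in ltRHS](card_ord d) -sumr_const.
apply: ltr_sum; first by apply/hasP; exists (Ordinal d0) => //; rewrite mem_index_enum.
by move=> i _; rewrite !mxE distrC h.
Qed.

Lemma Linfty_norm_ae Omega (g : 'rV[R]_d -> R) (r : R) :
  (Linfty_norm Omega g <= r%:E)%E -> {ae leb, forall x, Omega x -> `|g x| <= r}.
Proof.
(* The norm is the essential supremum provided that the whole space has positive measure, which the
   unit ball ensures. *)
rewrite /Linfty_norm unlock ifT; last first.
  apply: lt_le_trans (@lebesgue_rV_ball_le R d 0 1 setT ltr01 measurableT (@subsetT _ _)).
  by rewrite lte_fin exprn_gt0// mulr1.
move/ess_supP; apply: filterS => x /= + Ox.
by rewrite patchE mem_set// lee_fin.
Qed.

Lemma sobolev_norm_on_le Omega (tau : R) f F :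
  (forall x, Omega x -> f x = F x) ->
  (sobolev_norm_on Omega tau f <= sobolev_norm tau F)%E.
Proof.
move=> fF; apply: ereal_inf_le; exists (sobolev_norm tau F) => //.
by exists F => //; exact: aeW.
Qed.

Section native_witness.
Variables (Omega : set 'rV[R]_d) (k : 'rV[R]_d -> 'rV[R]_d -> R)
  (Phi : 'rV[R]_d -> R) (tau : R) (H : native_space Omega k).

(** Norm equivalence provides an element equal to F almost everywhere on [Omega]. Both functions are
    continuous on [Omega], the closure of its interior, so they agree at each of its points. *)
Lemma sobolev_native_witness (F : 'rV[R]_d -> R) :
  closure (interior Omega) = Omega -> continuous Phi ->
  translational_invariant Omega k Phi -> norm_equiv_sobolev H tau ->
  continuous F -> (sobolev_norm tau F < +oo)%E ->
  exists2 f, carrier H f & forall x, Omega x -> f x = F x.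
Proof.
move=> cl cPhi ti [_ ext] cF Foo.
have [|f Hf fF] := ext F.
  by apply: le_lt_trans Foo; exact: sobolev_norm_on_le.
exists f => // x Ox.
have cf := native_continuous cPhi ti Hf.
have cd : {within Omega, continuous (fun y => `|f y - F y|)}.
  apply/subspace_continuousP => y Oy.
  apply: (@cvg_norm _ R^o); apply: (@cvgB _ R^o).
    by move/subspace_continuousP : cf; exact.
  by apply: cvg_within_filter; exact: cF.
have : {ae leb, forall y, Omega y -> `|f y - F y| <= 0}.
  by apply: filterS fF => y /= fFy /fFy ->; rewrite subrr normr0.
move/(ae_le_within cl cd)/(_ _ Ox); rewrite normr_le0 subr_eq0.
by move/eqP.
Qed.
End native_witness.
End witness.

(** * The bound on the fill distance *)

Theorem lemma12 (R : realType) (d : nat) (Omega : set 'rV[R]_d)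
    (k : 'rV[R]_d -> 'rV[R]_d -> R) (Phi : 'rV[R]_d -> R) (tau : R)
    (H : native_space Omega k) :
  (0 < d)%N ->
  compact_domain Omega ->
  interior_cone_condition Omega ->
  strictly_pd_kernel Omega k ->
  translational_invariant Omega k Phi ->
  d%:R / 2 < tau ->
  finite_smoothness H tau Phi ->
  exists2 M : R, 0 < M &
    forall (eps : R) (N : nat) (X : 'I_N -> 'rV[R]_d),
      0 < eps -> (0 < N)%N -> injective X -> (forall i, Omega (X i)) ->
      (forall f, carrier H f ->
         (Linfty_norm Omega (f \- orth_proj H (kernel_span Omega k X) f)%R
          <= (eps * native_norm H f)%:E)%E) ->
      fill_distance Omega X <= M * eps `^ (tau - d%:R / 2)^-1.
Proof.
move=> d0 [cO nO cl] _ _ ti dtau [[cPhi _] neq].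
have dR0 : 0 < d%:R :> R by rewrite ltr0n.
have tau0 : 0 <= tau by apply/ltW; apply: le_lt_trans dtau; rewrite divr_ge0.
have s0 : 0 < tau - d%:R / 2 by rewrite subr_gt0.
have [B OB] := compact_coord_bound cO.
(* A bound for every radius used below: coordinates of differences of points of [Omega] are at most
   2 B in absolute value. *)
have D1 : 1 <= 1 + `|2 * B| by rewrite lerDl.
have [Cs Cs0 sobF] := sobolev_norm_bump d tau0
  (ltW (archi_boundP tau0)) D1.
have [[c [C [_ C0 nC]]] _] := neq.
(* The factor d comes from q = d rho, the power from solving rho^(tau - d/2) <= C Cs eps for rho. *)
exists (d%:R * (C * Cs) `^ (tau - d%:R / 2)^-1).
  by rewrite mulr_gt0// powR_gt0// mulr_gt0.
move=> eps N X eps0 N0 _ XO projX.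
apply: ge_sup; first by case: nO => x Ox; exists (inf (range (fun i => enorm (x - X i)))), x.
move=> _ [x Ox <-]; set q := inf _.
have qX i : q <= enorm (x - X i).
  apply: ge_inf; last by exists i.
  by exists 0 => _ [j _ <-]; exact: sqrtr_ge0.
have [q0|q0] := leP q 0.
  by apply: (le_trans q0); rewrite !mulr_ge0 ?powR_ge0// ltW.
(* The radius for which [bump_rV_eq0] makes the bump vanish at every point at distance at least q
   from x, hence on X. *)
pose rho := q / d%:R.
have rho0 : 0 < rho by rewrite divr_gt0.
have drho : d%:R * rho = q by rewrite mulrC divfK// gt_eqF.
have rhoD : rho <= 1 + `|2 * B|.
  rewrite /rho ler_pdivrMr//; apply: (le_trans (qX (Ordinal N0))).
  apply: le_trans (enorm_le_sum _) _.
  rewrite mulr_natr -[in leRHS](card_ord d) -sumr_const.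
  apply: ler_sum => i _; rewrite !mxE.
  have := ler_normB (x 0 i) (X (Ordinal N0) 0 i).
  have := OB _ i Ox; have := OB _ i (XO (Ordinal N0)); have := ler_norm (2 * B); lra.
set m := Num.bound tau in sobF.
have sF := sobF x rho rho0 rhoD.
have [||f Hf fF] := @sobolev_native_witness _ _ _ _ Phi tau H
  (bump_rV m.+1 x rho) cl cPhi ti neq.
- exact: continuous_bump_rV.
- by apply: le_lt_trans sF _; exact: ltry.
have fX i : f (X i) = 0.
  by rewrite fF// bump_rV_eq0// drho.
have fx : f x = 1 by rewrite fF// bump_rV_center.
have nf : native_norm H f <= C * (Cs * rho `^ (d%:R / 2 - tau)).
  rewrite -lee_fin; have [_ h] := nC f Hf; apply: (le_trans h).
  rewrite EFinM; apply: lee_wpmul2l; first by rewrite lee_fin ltW.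
  by apply: le_trans sF; exact: sobolev_norm_on_le.
(* The error is f itself, so |f| <= eps |f|_H almost everywhere on [Omega]; continuity of f extends
   this to x, where f is 1. *)
have := projX f Hf; rewrite orth_proj_eq0//.
move/Linfty_norm_ae/(ae_le_within cl) => /(_ _ x Ox).
rewrite /= subr0 fx normr1 => h1.
have {h1} : 1 <= eps * native_norm H f.
  apply: h1; have cf := native_continuous cPhi ti Hf.
  apply/subspace_continuousP => y Oy.
  apply: (@cvg_norm _ R^o); apply: (@cvgB _ R^o); last exact: cvg_cst.
  by move/subspace_continuousP : cf; exact.
move=> h1; have {h1 nf} h1 := le_trans h1 (ler_wpM2l (ltW eps0) nf).
have e1 : rho `^ (d%:R / 2 - tau) = (rho `^ (tau - d%:R / 2))^-1.
  by rewrite -powRN opprB.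
have {h1}h1 : rho `^ (tau - d%:R / 2) <= C * Cs * eps.
  move: h1; rewrite e1 !mulrA ler_pdivlMr ?powR_gt0// mul1r.
  by rewrite [C * _ * _]mulrC mulrA.
have CCs0 : 0 < C * Cs by rewrite mulr_gt0.
rewrite -drho -mulrA ler_wpM2l ?(ltW dR0)//.
rewrite -powRM ?(ltW eps0) ?(ltW CCs0)//.
(* Writing rho as a power of its power allows the monotone root to be applied to both sides. *)
have -> : rho = (rho `^ (tau - d%:R / 2)) `^ (tau - d%:R / 2)^-1.
  by rewrite -powRrM divff ?gt_eqF// powRr1// ltW.
apply: ge0_ler_powR => //.
- by rewrite invr_ge0 ltW.
- by rewrite nnegrE powR_ge0.
- by rewrite nnegrE mulr_ge0// ltW.
Qed.
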